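(* Let $M$ be a smooth manifold endowed with a Riemannian metric, let $X, Y$ be smooth submanifolds of $M$ with $Y \subset \overline{X}$, and let $(T_Y,\pi,\rho)$ be a smooth tubular neighbourhood for $Y$ with associated projection $\pi$ and smooth non-negative control function $\rho$ satisfying $\rho^{-1}(0)=Y$ and $\operatorname{grad}\rho(x)\in \operatorname{Ker} d\pi(x)$. Let $y_0\in Y$. Suppose that the pair $(X,Y)$ is Whitney $(a)$-regular at $y_0$, satisfies condition $(m)$ for the control function $\rho$, and satisfies condition $(c_d)$ at $y_0$ (with respect to $\rho$). Then $(X,Y)$ is $(c)$-regular at $y_0$ for the function $\rho$.
   Context: Setting: $T_Y$ is a tubular neighbourhood of $Y$ in $M$, $\pi: T_Y\to Y$ its smooth projection, and $\rho: T_Y\to[0,\infty)$ is smooth. Whitney $(a)$-regularity at $y_0\in Y$: for any sequence of points $\{x_i\}$ of $X$ tending to $y_0$ such that the tangent spaces $T_{x_i}X$ tend to some plane $\sigma$ in the Grassmann space of $\dim X$-planes, one has $T_{y_0}Y\subset\sigma$. $(c)$-regularity at $y_0\in Y$ for the control function $\rho$: for any sequence of points $\{x_i\}$ of $X$ tending to $y_0$ such that the planes $\operatorname{Ker} d\rho(x_i)\cap T_{x_i}X$ tend to some plane $\tau$ in the Grassmann space of $(\dim X-1)$-planes, one has $T_{y_0}Y\subset\tau$. Condition $(m)$: there exists $\epsilon>0$ such that $(\pi,\rho)|_{X\cap T_Y^\epsilon}: X\cap T_Y^\epsilon\to Y\times\mathbb{R}$ is a submersion, where $T_Y^\epsilon:=\{x\in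 T_Y \mid \rho(x)<\epsilon\}$. Pre-regular sequence: a sequence $\{x_i\}$ of points of $X$ tending to $y_0$ such that the planes $\operatorname{Ker} d\rho(x_i)\cap T_{x_i}X$ tend to some plane $\tau$ in the Grassmann space of $(\dim X-1)$-planes. After taking a subsequence one may assume that $\operatorname{Ker} d\rho(x_i)$ and $T_{x_i}X$ tend to planes $\mu$ and $\sigma$ in the Grassmann spaces of $(\dim M-1)$-planes and $\dim X$-planes, respectively. Condition $(c_d)$ at $y_0$: for any pre-regular sequence of points of $X$ tending to $y_0$ (passed to a subsequence for which the limits $\mu$ and $\sigma$ exist), $\dim(\mu\cap\sigma)=\dim X-1$. *)

(* Defs.v *)
From mathcomp Require Import all_boot all_order all_algebra.
From mathcomp Require Import all_classical all_reals all_analysis.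

Set Implicit Arguments.
Unset Strict Implicit.
Unset Printing Implicit Defensive.

Import Order.TTheory GRing.Theory Num.Theory.
Import numFieldNormedType.Exports.

Local Open Scope classical_set_scope.
Local Open Scope ring_scope.

(** * C^infinity functions between normed spaces *)

(* [U] is meant to be open and [V] finite-dimensional; then [Ck k U f] is the
   usual "f is of class C^k on U". *)
Fixpoint Ck (R : realType) (V W : normedModType R) (k : nat) (U : set V)
    (f : V -> W) : Prop :=
  if k is k'.+1 then
    (forall x, U x -> differentiable f x) /\
    (forall v : V, Ck k' U (fun x => 'D_v f x))
  else forall x, U x -> {for x, continuous f}.

Definition smooth_on (R : realType) (V W : normedModType R) (U : set V)
    (f : V -> W) : Prop :=
  forall k, Ck k U f.

(** * Smooth manifolds *)

Record chart (R : realType) (m : nat) (M : topologicalType) := Chart {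
  chart_dom : set M;
  chart_fun :> M -> 'rV[R]_m;
  chart_inv : 'rV[R]_m -> M;
  chart_dom_open : open chart_dom;
  chart_cod_open : open (chart_fun @` chart_dom);
  chart_funK : forall p, chart_dom p -> chart_inv (chart_fun p) = p;
  chart_fun_continuous : forall p, chart_dom p -> {for p, continuous chart_fun};
  chart_inv_continuous : forall u, (chart_fun @` chart_dom) u ->
    {for u, continuous chart_inv}
}.

Definition smooth_transition (R : realType) (m : nat) (M : topologicalType)
    (c d : chart R m M) : Prop :=
  smooth_on (c @` (chart_dom c `&` chart_dom d)) (d \o chart_inv c).

(* The atlas is indexed by the points of the manifold.  The tangent space at
   [p] is then ['rV[R]_m]: a tangent vector at [p] is represented by its
   coordinates in the chart [chart_at p]. *)
Record manifold (R : realType) (m : nat) := Manifold {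
  carrier :> topologicalType;
  chart_at : carrier -> chart R m carrier;
  manifold_hausdorff : hausdorff_space carrier;
  manifold_second_countable : second_countable (T := carrier);
  chart_at_dom : forall p, chart_dom (chart_at p) p;
  chart_at_smooth : forall p q, smooth_transition (chart_at p) (chart_at q)
}.

Definition tangent_vector (R : realType) (m : nat) (M : manifold R m) (p : M) :=
  'rV[R]_m.

(* Charts of the maximal atlas. *)
Definition smooth_chart (R : realType) (m : nat) (M : manifold R m)
    (c : chart R m M) : Prop :=
  forall p, smooth_transition (chart_at p) c /\ smooth_transition c (chart_at p).

Definition smooth_fun_at (R : realType) (m : nat) (M : manifold R m)
    (V : normedModType R) (h : M -> V) (p : M) : Prop :=
  exists O : set M, [/\ open O, O p, O `<=` chart_dom (chart_at p) &
    smooth_on (chart_at p @` O) (h \o chart_inv (chart_at p))].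

(* Differential at [p] of a function with values in a normed space. *)
Definition dfun (R : realType) (m : nat) (M : manifold R m)
    (V : normedModType R) (h : M -> V) (p : M) (v : tangent_vector p) : V :=
  'd (h \o chart_inv (chart_at p)) (chart_at p p) v.
Arguments dfun {R m M V} h p v.

Definition smooth_map_at (R : realType) (m : nat) (M : manifold R m)
    (n : nat) (N : manifold R n) (f : M -> N) (p : M) : Prop :=
  (\forall q \near p, chart_dom (chart_at (f p)) (f q)) /\
  smooth_fun_at (chart_at (f p) \o f) p.

Definition dmap (R : realType) (m : nat) (M : manifold R m)
    (n : nat) (N : manifold R n) (f : M -> N) (p : M) (v : tangent_vector p) :
    tangent_vector (f p) :=
  dfun (chart_at (f p) \o f) p v.
Arguments dmap {R m M n N} f p v.

(** * Submanifolds and their tangent spaces *)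

(* Embedded submanifold of dimension [n]. *)
Definition submanifold (R : realType) (m : nat) (M : manifold R m) (n : nat)
    (X : set M) : Prop :=
  (n <= m)%N /\
  forall x, X x -> exists c : chart R m M,
    [/\ smooth_chart c, chart_dom c x &
        forall p, chart_dom c p ->
          (X p <-> forall j : 'I_m, (n <= j)%N -> c p 0 j = 0)].

(* Velocities at [x] of the smooth curves drawn on [X]. *)
Definition tangent (R : realType) (m : nat) (M : manifold R m) (X : set M)
    (x : M) : set (tangent_vector x) :=
  [set v | exists (c : R -> M) (e : R), [/\ 0 < e, c 0 = x,
     forall t, ball (0 : R) e t -> X (c t) /\ chart_dom (chart_at x) (c t),
     smooth_on (ball (0 : R) e) (chart_at x \o c) &
     v = derive1 (chart_at x \o c) 0]].
Arguments tangent {R m M} X x _.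

(** * Riemannian metrics *)

(* The vector at [p] whose coordinates in the chart [chart_at q] are [w]. *)
Definition coord_vector (R : realType) (m : nat) (M : manifold R m) (q : M)
    (w : 'rV[R]_m) (p : M) : tangent_vector p :=
  'd (chart_at p \o chart_inv (chart_at q)) (chart_at q p) w.

(* The inner product on the tangent space at [p] is given by its Gram matrix. *)
Definition gram_inner (R : realType) (m : nat) (G : 'M[R]_m) (v w : 'rV[R]_m)
    : R :=
  (v *m G *m w^T) 0 0.

Record riemannian_metric (R : realType) (m : nat) (M : manifold R m) :=
  RiemannianMetric {
  gram : M -> 'M[R]_m;
  gram_sym : forall p, (gram p)^T = gram p;
  gram_posdef : forall p v, v != 0 -> 0 < gram_inner (gram p) v v;
  gram_smooth : forall q w1 w2 p, chart_dom (chart_at q) p ->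
    smooth_fun_at
      (fun p' => gram_inner (gram p') (coord_vector q w1 p')
                   (coord_vector q w2 p') : R) p
}.

Definition grad (R : realType) (m : nat) (M : manifold R m)
    (g : riemannian_metric M) (rho : M -> R) (x : M) : tangent_vector x :=
  xget 0 [set w | forall v : tangent_vector x,
                    gram_inner (gram g x) w v = dfun rho x v].

(** * Tubular neighbourhoods *)

(* Smooth vector bundle of rank [r] over a [k]-dimensional submanifold [Y].
   [vb_add] is only meaningful on pairs of points of the same fibre; the vector
   space axioms follow from the local trivializations. A local trivialization
   over [U] is given by its fibre component [theta]; the last two clauses say
   that [(vb_proj, theta)], from the part of the bundle above [U] to
   [(Y `&` U) * 'rV_r], is a bijection with invertible differential (the two
   sides have the same dimension), i.e. a diffeomorphism. *)
Record vector_bundle (R : realType) (m : nat) (M : manifold R m) (Y : set M)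
    (k r : nat) := VectorBundle {
  vb_total :> manifold R (k + r);
  vb_proj : vb_total -> M;
  vb_add : vb_total -> vb_total -> vb_total;
  vb_scale : R -> vb_total -> vb_total;
  vb_proj_base : forall e, Y (vb_proj e);
  vb_proj_smooth : forall e, smooth_map_at vb_proj e;
  vb_proj_add : forall e e', vb_proj e = vb_proj e' ->
    vb_proj (vb_add e e') = vb_proj e;
  vb_proj_scale : forall a e, vb_proj (vb_scale a e) = vb_proj e;
  vb_locally_trivial : forall y, Y y ->
    exists (U : set M) (theta : vb_total -> 'rV[R]_r),
    [/\ open U /\ U y,
        (forall e, U (vb_proj e) -> smooth_fun_at theta e),
        (forall e e', U (vb_proj e) -> vb_proj e = vb_proj e' ->
           theta (vb_add e e') = theta e + theta e') /\
        (forall a e, U (vb_proj e) -> theta (vb_scale a e) = a *: theta e),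
        (forall y' w, Y y' -> U y' ->
           exists! e, vb_proj e = y' /\ theta e = w) &
        (forall e (v : tangent_vector e), U (vb_proj e) ->
           dmap vb_proj e v = 0 -> dfun theta e v = 0 -> v = 0)]
}.

(* [T] is the diffeomorphic image, under [phi], of an open neighbourhood [D] of
   the zero section of a vector bundle over [Y]; [phi] is the identity on the
   zero section and commutes with the projections.  The zero of the fibre
   through [e] is [vb_scale 0 e]. *)
Definition tubular_neighbourhood (R : realType) (m : nat) (M : manifold R m)
    (k : nat) (Y T : set M) (pi : M -> M) : Prop :=
  [/\ open T, Y `<=` T &
   exists (E : vector_bundle Y k (m - k)) (D : set E) (phi : E -> M)
     (phi' : M -> E),
   [/\ open D /\ (forall e : E, D (vb_scale 0 e)),
       (forall e, D e -> smooth_map_at phi e) /\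
       (forall x, T x -> smooth_map_at phi' x),
       (forall e, D e -> T (phi e) /\ phi' (phi e) = e) /\
       (forall x, T x -> D (phi' x) /\ phi (phi' x) = x),
       (forall e : E, phi (vb_scale 0 e) = vb_proj e) &
       (forall e, D e -> pi (phi e) = vb_proj e)]].

Definition control_function (R : realType) (m : nat) (M : manifold R m)
    (g : riemannian_metric M) (Y T : set M) (pi : M -> M) (rho : M -> R) :
    Prop :=
  [/\ (forall x, T x -> smooth_fun_at (rho : M -> R) x),
      (forall x, T x -> 0 <= rho x),
      (forall x, T x -> (rho x = 0 <-> Y x)) &
      (forall x, T x -> dmap pi x (grad g rho x) = 0)].

(** * Limits of planes *)

Definition frame (R : realType) (m d : nat) (A : 'M[R]_(d, m))
    (P : set 'rV[R]_m) : Prop :=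
  row_free A /\ P = [set v | (v <= A)%MS].

(* [P] is a [d]-dimensional vector subspace. *)
Definition plane (R : realType) (m d : nat) (P : set 'rV[R]_m) : Prop :=
  exists A : 'M[R]_(d, m), frame A P.

(* The [P i], subspaces of the tangent spaces at [x i], converge to the subspace
   [Q] of the tangent space at [y] in the bundle of Grassmannians of [d]-planes
   of [M]; this bundle is trivialized around [y] by the chart at [y].  A
   Grassmannian has the quotient topology of the space of [d]-frames by the
   (open) map sending a frame to its span, so that convergent sequences of
   planes are exactly those that lift to convergent sequences of frames. *)
Definition planes_cvg (R : realType) (m : nat) (M : manifold R m) (d : nat)
    (x : nat -> M) (P : forall i, set (tangent_vector (x i)))
    (y : M) (Q : set (tangent_vector y)) : Prop :=
  exists (A : nat -> 'M[R]_(d, m)) (B : 'M[R]_(d, m)),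
  [/\ (\forall i \near \oo, chart_dom (chart_at y) (x i) /\
         frame (A i) (dfun (chart_at y) (x i) @` P i)),
      frame B Q &
      A @ \oo --> B].
Arguments planes_cvg {R m M} d x P y Q.

(** * Regularity conditions *)

Definition ker_d (R : realType) (m : nat) (M : manifold R m) (rho : M -> R)
    (x : M) : set (tangent_vector x) :=
  [set v | dfun rho x v = 0].
Arguments ker_d {R m M} rho x _.

(* In what follows [n] is the dimension of [X]. *)

Definition whitney_a (R : realType) (m : nat) (M : manifold R m)
    (n : nat) (X Y : set M) (y0 : M) : Prop :=
  forall (x : nat -> M) (sigma : set (tangent_vector y0)),
    (forall i, X (x i)) -> x @ \oo --> y0 ->
    planes_cvg n x (fun i => tangent X (x i)) y0 sigma ->
    tangent Y y0 `<=` sigma.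

Definition pre_regular (R : realType) (m : nat) (M : manifold R m)
    (n : nat) (X : set M) (rho : M -> R) (y0 : M)
    (x : nat -> M) (tau : set (tangent_vector y0)) : Prop :=
  [/\ forall i, X (x i), x @ \oo --> y0 &
      planes_cvg n.-1 x (fun i => ker_d rho (x i) `&` tangent X (x i)) y0 tau].
Arguments pre_regular {R m M} n X rho y0 x tau.

Definition c_regular (R : realType) (m : nat) (M : manifold R m)
    (n : nat) (X Y : set M) (rho : M -> R) (y0 : M) : Prop :=
  forall x tau, pre_regular n X rho y0 x tau -> tangent Y y0 `<=` tau.

(* [(pi, rho)] restricted to [X `&` [set x | T x /\ rho x < eps]] is a
   submersion to [Y * R]. *)
Definition condition_m (R : realType) (m : nat) (M : manifold R m)
    (X Y T : set M) (pi : M -> M) (rho : M -> R) : Prop :=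
  exists2 eps : R, 0 < eps & forall x, X x -> T x -> rho x < eps ->
    forall (w : tangent_vector (pi x)) (s : R), tangent Y (pi x) w ->
      exists2 v : tangent_vector x, tangent X x v &
        dmap pi x v = w /\ dfun rho x v = s.

Definition condition_cd (R : realType) (m : nat) (M : manifold R m)
    (n : nat) (X : set M) (rho : M -> R) (y0 : M) : Prop :=
  forall x tau (mu sigma : set (tangent_vector y0)),
    pre_regular n X rho y0 x tau ->
    planes_cvg m.-1 x (fun i => ker_d rho (x i)) y0 mu ->
    planes_cvg n x (fun i => tangent X (x i)) y0 sigma ->
    plane n.-1 (mu `&` sigma).

(* Main.v *)
(** Let [c] be the chart at [y0], [r] and [F] the expressions of [rho] and [pi]
    in [c].  As [grad rho] lies in [Ker d pi], the metric orthogonal of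
    [Ker d pi] is killed by [d rho]; it is spanned by continuous vector fields.
    Starting from [y0], one can follow such a field [V] approximately while
    keeping [rho] at its minimal value [0], hence inside [Y], so that [V y0] is
    tangent to [Y]; since [pi] is the identity on [Y], the dimensions agree and
    [T_y0 Y] is exactly the orthogonal of [Ker d pi] at [y0].  Every vector of
    [T_y0 Y] is therefore a limit of vectors of [Ker d rho (x_i)], which gives
    [T_y0 Y] inside [mu]; Whitney (a) gives [T_y0 Y] inside [sigma], and [(c_d)]
    forces [tau] to be the intersection of [mu] and [sigma]. *)

Require Import Defs.
From mathcomp Require Import all_boot all_order all_algebra.
From mathcomp Require Import all_classical all_reals all_analysis.
From mathcomp Require Import zify ring lra.

Set Implicit Arguments.
Unset Strict Implicit.
Unset Printing Implicit Defensive.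

Import Order.TTheory GRing.Theory Num.Theory.
Import numFieldNormedType.Exports.

Local Open Scope classical_set_scope.
Local Open Scope ring_scope.

(** * Differentials and limits of matrices *)

(** The first-order expansion of [f] at [x] is also one of [g], and the linear part of such an
    expansion is unique. *)
Lemma near_eq_diff (R : realType) (V W : normedModType R) (f g : V -> W)
    (x : V) :
  differentiable f x -> {near x, f =1 g} ->
  differentiable g x /\ 'd g x = 'd f x :> (V -> W).
Proof.
move=> df fg.
have dg : g \o shift x = cst (g x) + 'd f x +o_ 0 id.
  apply/eqaddoP => e e0.
  have fg0 : \forall h \near (0 : V), f (h + x) = g (h + x).
    have : \forall y \near x, f y = g y by [].
    by rewrite (near_shift 0) subr0.
  have /diff_locally /eqaddoP/(_ e e0) := df.
  apply: filterS2 fg0 => h; rewrite !fctE /= => <-.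
  by rewrite (nbhs_singleton fg).
have dgf := diff_unique (diff_continuous df) dg.
by split => //; apply/diff_locallyP; rewrite dgf; split => //;
  exact: diff_continuous.
Qed.

(** Chain rule for maps read in charts, which are composites only near the point. *)
Lemma diff_comp_near (R : realType) (U V W : normedModType R) (f : U -> V)
    (g : V -> W) (h : U -> W) (x : U) :
  differentiable f x -> differentiable g (f x) -> {near x, g \o f =1 h} ->
  differentiable h x /\ forall v, 'd h x v = 'd g (f x) ('d f x v).
Proof.
move=> df dg gfh; have dgf := differentiable_comp df dg.
by have [dh ->] := near_eq_diff dgf gfh; split => // v; rewrite diff_comp.
Qed.

Lemma diff_id_near (R : realType) (V : normedModType R) (f : V -> V) (x : V) :
  {near x, f =1 id} -> forall v, 'd f x v = v.
Proof.
move=> fid v; have [] := @near_eq_diff _ _ _ id f x => //.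
  by apply: filterS fid.
by move=> _ ->; rewrite (@diff_val _ _ _ _ _ _ id).
Qed.

Lemma diff_approx (R : realType) (V W : normedModType R) (f : V -> W) (x : V) :
  differentiable f x -> forall e, 0 < e ->
  \forall h \near 0, `|f (x + h) - f x - 'd f x h| <= e * `|h|.
Proof.
move=> /diff_locally /eqaddoP df e /df; apply: filterS => h.
by rewrite !fctE /= opprD addrA [h + x]addrC.
Qed.

Lemma smooth_on_differentiable (R : realType) (V W : normedModType R)
    (U : set V) (f : V -> W) (x : V) :
  smooth_on U f -> U x -> differentiable f x.
Proof. by move=> /(_ 1%N)[+ _]; apply. Qed.

Lemma smooth_on_derive_continuous (R : realType) (V W : normedModType R)
    (U : set V) (f : V -> W) (x v : V) :
  smooth_on U f -> U x -> {for x, continuous (fun y => 'D_v f y)}.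
Proof. by move=> /(_ 1%N)[_ +]; apply. Qed.

Lemma cvg_mx (R : realType) (T : Type) (F : set_system T) (FF : Filter F)
    (p q : nat) (A : T -> 'M[R]_(p, q)) (B : 'M[R]_(p, q)) :
  (A @ F --> B) <-> (forall i j, (fun t => A t i j) @ F --> B i j).
Proof.
split=> [AB i j|AB].
  apply: (@cvg_comp _ _ _ A (fun M : 'M[R]_(p, q) => M i j) F (nbhs B)) => //.
  exact: coord_continuous.
apply/cvgrPdist_le => e e0.
near=> x.
rewrite /Num.Def.normr/= mx_normrE (bigmax_le _ (ltW e0))//= => i _.
rewrite !mxE.
move: i; near: x; apply: filter_forall => /= i.
exact: ((cvgrPdist_le _ _).1 (AB i.1 i.2)).
Unshelve. all: by end_near. Qed.

Section MatrixLimits.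
Context (R : realType) (T : Type) (F : set_system T) {FF : Filter F}.

Lemma cvg_mulmx (p q r : nat) (A : T -> 'M[R]_(p, q)) (B : T -> 'M[R]_(q, r))
    (A0 : 'M[R]_(p, q)) (B0 : 'M[R]_(q, r)) :
  A @ F --> A0 -> B @ F --> B0 -> (fun t => A t *m B t) @ F --> A0 *m B0.
Proof.
move=> /(cvg_mx FF) cA /(cvg_mx FF) cB; apply/(cvg_mx FF) => i j.
rewrite mxE; under eq_fun do rewrite mxE.
by apply: cvg_big => [|l _];
  [exact: add_continuous|apply: cvgM; [exact: cA|exact: cB]].
Qed.

Lemma cvg_trmx (p q : nat) (A : T -> 'M[R]_(p, q)) (A0 : 'M[R]_(p, q)) :
  A @ F --> A0 -> (fun t => (A t)^T) @ F --> A0^T.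
Proof.
move=> /(cvg_mx FF) cA; apply/(cvg_mx FF) => i j.
by rewrite mxE; under eq_fun do rewrite mxE; exact: cA.
Qed.

Lemma cvg_bigprod (I : Type) (s : seq I) (f : I -> T -> R) (l : I -> R) :
  (forall i, f i @ F --> l i) ->
  (fun t => \prod_(i <- s) f i t) @ F --> \prod_(i <- s) l i.
Proof.
by move=> fl; apply: cvg_big => //; exact: mul_continuous.
Qed.

Lemma cvg_det (p : nat) (A : T -> 'M[R]_p) (A0 : 'M[R]_p) :
  A @ F --> A0 -> (fun t => \det (A t)) @ F --> \det A0.
Proof.
move=> /(cvg_mx FF) cA; rewrite /determinant.
apply: cvg_big => [|s _]; [exact: add_continuous|apply: cvgM];
  first exact: cvg_cst.
by apply: cvg_bigprod => i; exact: cA.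
Qed.

(** The adjugate stands in for the inverse: it is polynomial in the entries, hence continuous
    everywhere. *)
Lemma cvg_adjugate (p : nat) (A : T -> 'M[R]_p) (A0 : 'M[R]_p) :
  A @ F --> A0 -> (fun t => \adj (A t)) @ F --> \adj A0.
Proof.
move=> /(cvg_mx FF) cA; apply/(cvg_mx FF) => i j.
rewrite mxE; under eq_fun do rewrite mxE.
apply: cvgM; first exact: cvg_cst.
apply: cvg_det; apply/(cvg_mx FF) => a b.
by rewrite !mxE; under eq_fun do rewrite !mxE; exact: cA.
Qed.

Lemma cvg_col_mx (p q r : nat) (A : T -> 'M[R]_(p, r)) (B : T -> 'M[R]_(q, r))
    (A0 : 'M[R]_(p, r)) (B0 : 'M[R]_(q, r)) :
  A @ F --> A0 -> B @ F --> B0 ->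
  (fun t => col_mx (A t) (B t)) @ F --> col_mx A0 B0.
Proof.
move=> /(cvg_mx FF) cA /(cvg_mx FF) cB; apply/(cvg_mx FF) => i j.
rewrite mxE; under eq_fun do rewrite mxE.
by case: splitP => a _; [exact: cA|exact: cB].
Qed.

End MatrixLimits.

Lemma near_eq_continuous (S T : topologicalType) (f g : S -> T) (x : S) :
  (\forall y \near x, f y = g y) -> {for x, continuous f} ->
  {for x, continuous g}.
Proof.
move=> fg cf; apply: (@cvg_trans _ (f @ x)); first exact: near_eq_cvg.
by rewrite -(nbhs_singleton fg).
Qed.

(** Vectors are rows: entry [(i, j)] is the [j]-th coordinate of the derivative along the [i]-th
    basis vector, which is continuous by smoothness. *)
Lemma jacobian_continuous (R : realType) (p q : nat) (U : set 'rV[R]_p)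
    (f : 'rV[R]_p -> 'rV[R]_q) (x : 'rV[R]_p) :
  smooth_on U f -> nbhs x U -> {for x, continuous (jacobian f)}.
Proof.
move=> sf Ux; apply/(cvg_mx (nbhs_filter x)) => i j.
have Ux' := nbhs_singleton Ux.
have E y : U y -> jacobian f y i j = 'D_(delta_mx 0 i) f y 0 j.
  move=> Uy; rewrite deriveEjacobian;
    last exact: smooth_on_differentiable sf Uy.
  by rewrite -rowE; apply: esym; apply: mxE.
apply: (near_eq_continuous (f := fun y => 'D_(delta_mx 0 i) f y 0 j)).
  by apply: filterS Ux => y /E ->.
have := @smooth_on_derive_continuous _ _ _ _ _ x (delta_mx 0 i) sf Ux'.
by move=> /(cvg_mx (nbhs_filter x)); apply.
Qed.

(** * Zero sets of functions constant along a vector field *)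

Lemma compact_norm_le (R : realType) (q : nat) (d : R) :
  compact [set w : 'rV[R]_q | `|w| <= d].
Proof.
apply: bounded_closed_compact.
  exists d; split; first exact: num_real.
  by move=> M dM w /= /le_trans; apply; exact: ltW.
apply: (@closed_comp _ _ (fun w : 'rV[R]_q => `|w|) [set x | x <= d]).
  by move=> w _; exact: norm_continuous.
exact: closed_le.
Qed.

(** [phi i] is an index beyond [i] at which [a] is within [1 / (i + 1)] of a cluster point. The
    bound [i <= phi i], weaker than monotonicity, is enough to carry limits along. *)
Lemma bounded_cvg_subsequence (R : realType) (q : nat) (d : R)
    (a : nat -> 'rV[R]_q) :
  (forall i, `|a i| <= d) ->
  exists (phi : nat -> nat) (l : 'rV[R]_q),
    (forall i, (i <= phi i)%N) /\ a \o phi @ \oo --> l.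
Proof.
move=> ad.
have ad' : (a @ \oo) [set w | `|w| <= d].
  by rewrite /fmap /=; apply: filterS filterT => i _; exact: ad.
have [l [_ cl]] := @compact_norm_le R q d _ _ ad'.
have near_l n : exists i, (n <= i)%N /\ `|l - a i| < n.+1%:R^-1.
  have [_ [[i /= ni <-] li]] :
      (a @` [set i | (n <= i)%N]) `&` ball l n.+1%:R^-1 !=set0.
    apply: cl; last by apply: nbhsx_ballx; rewrite invr_gt0.
    by exists n => // i ni; exists i.
  by exists i; split => //; move: li; rewrite -ball_normE.
have [phi phiP] := choice near_l.
exists phi, l; split=> [i|]; first by have [] := phiP i.
apply/cvgrPdist_lt => e e0.
have := near_infty_natSinv_lt (PosNum e0).
by apply: filterS => n /(lt_trans (phiP n).2).
Qed.

Section ZeroSetViability.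
Context (R : realType) (m : nat).
Variables (r : 'rV[R]_m -> R) (u0 : 'rV[R]_m) (V : 'rV[R]_m -> 'rV[R]_m).
Hypothesis r_diff : \forall u \near u0, differentiable r u.
Hypothesis r_V : \forall u \near u0, 'd r u (V u) = 0.
Hypothesis V_cont : {for u0, continuous V}.
Hypothesis r_ge0 : \forall u \near u0, 0 <= r u.
Hypothesis r0 : r u0 = 0.

(** For [s >= 0] and [|w| <= d], these points form a cone with apex [u0] around the direction
    [V u0]. *)
Let cone (s : R) (w : 'rV[R]_m) := u0 + s *: (V u0 + w).

(* Minimise [r (u0 + s (V u0 + w)) - e s] over [0 <= s <= s0], [|w| <= d]: moving
   along [V] decreases it, so the minimum is at [s = s0]; let then [e] tend to
   [0]. *)
Lemma viability (d : R) : 0 < d ->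
  \forall s \near 0^'+, exists2 w : 'rV[R]_m, `|w| <= d & r (cone s w) = 0.
Proof.
move=> d0; set v := V u0.
have /nbhs_ballP[D /= D0 nearD] : \forall u \near u0,
    [/\ differentiable r u, 'd r u (V u) = 0, `|V u - v| <= d & 0 <= r u].
  have Vd : \forall u \near u0, `|V u - v| <= d.
    have /cvgrPdist_le/(_ d d0) := V_cont.
    by apply: filterS => u; rewrite distrC.
  by near=> u; split; near: u.
have K0 : 0 < `|v| + d by rewrite ltr_wpDl.
near=> s0.
have s00 : 0 < s0 by near: s0; exact: nbhs_right_gt.
(* The whole cone up to time [s0] then lies in the ball where the local hypotheses hold. *)
have s0D : s0 * (`|v| + d) < D.
  rewrite -ltr_pdivlMr //; near: s0; apply: nbhs_right_lt.
  by rewrite divr_gt0.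
have coneD s w : 0 <= s -> s <= s0 -> `|w| <= d -> ball u0 D (cone s w).
  move=> s_ge0 ss0 wd;
    rewrite -ball_normE /ball_ /= /cone opprD addrA subrr sub0r.
  rewrite normrN normrZ ger0_norm // (le_lt_trans _ s0D) //.
  apply: ler_pM => //; apply: (le_trans (ler_normD _ _)); exact: lerD.
have cone_cont s w : {for (s, w), continuous (fun p => cone p.1 p.2)}.
  apply: cvgD; first exact: cvg_cst.
  apply: cvgZ; first exact: cvg_fst.
  by apply: cvgD; [exact: cvg_cst|exact: cvg_snd].
have cone_cont' s (w : 'rV[R]_m) :
    {for w, continuous (fun w' => u0 + s *: (V u0 + w'))}.
  apply: (cvgD (F := nbhs w)); first exact: cvg_cst.
  apply: (cvgZl_tmp (F := nbhs w)).
  by apply: (cvgD (F := nbhs w)); [exact: cvg_cst|exact: cvg_id].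
have r_cone_cont s w : 0 <= s -> s <= s0 -> `|w| <= d ->
    {for (s, w), continuous (fun p => r (cone p.1 p.2))}.
  move=> s_ge0 ss0 wd;
    apply: (@continuous_comp _ _ _ (fun p => cone p.1 p.2) r).
    exact: cone_cont.
  by apply: differentiable_continuous; case: (nearD _ (coneD _ _ s_ge0 ss0 wd)).
have small e : 0 < e -> exists2 w, `|w| <= d & r (cone s0 w) <= e * s0.
  move=> e0.
  have [] := @compact_EVT_min _ R (fun p => r (cone p.1 p.2) - e * p.1)
    (`[0, s0]%classic `*` [set w : 'rV[R]_m | `|w| <= d]).
  - by exists (0, 0); split => /=; rewrite ?in_itv /= ?lexx ?normr0 ?ltW.
  - by apply: compact_setX; [exact: segment_compact|exact: compact_norm_le].
  - apply: continuous_in_subspaceT => -[s w]; rewrite inE => -[/=].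
    rewrite in_itv /= => /andP[s_ge0 ss0] wd.
    apply: cvgB; first exact: r_cone_cont.
    by apply: cvgM; [exact: cvg_cst|exact: cvg_fst].
  move=> [s w]; rewrite inE => -[/=].
  rewrite in_itv /= => /andP[s_ge0 ss0] wd smin.
  have : s = s0 \/ s < s0.
    by move: ss0; rewrite le_eqVlt => /orP[/eqP|]; [left|right].
  have [] // := nearD _ (coneD _ _ s_ge0 ss0 wd).
  set u := cone s w => du dV Vd ru_ge0 [ss|ss].
    exists w => //.
    (* At the apex the penalised function is [0], so its minimum is at most [0]. *)
    have := smin (0, 0);
      rewrite inE /= in_itv /= lexx normr0 (ltW s00) (ltW d0).
    rewrite /u ss /cone scale0r addr0 r0 mulr0 subrr subr_le0; exact.
  (* moving along [V] strictly decreases [r - e * s] to first order *)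
  exfalso.
  have K'0 : 0 < `|V u| + 1 by rewrite ltr_wpDl.
  (* This slope bounds the first-order error over a step [t] by [e * t / 2], half of the gain
     [e * t]; the [+ 1] avoids dividing by zero. *)
  have e'0 : 0 < e / (`|V u| + 1) / 2 by rewrite !divr_gt0.
  have [t [t0 tss rt]] : exists t, [/\ 0 < t, s + t <= s0 &
      `|r (u + t *: V u) - r u - 'd r u (t *: V u)|
         <= e / (`|V u| + 1) / 2 * `|t *: V u|].
    suff : \forall t \near 0^'+, [/\ 0 < t, s + t <= s0 &
      `|r (u + t *: V u) - r u - 'd r u (t *: V u)|
         <= e / (`|V u| + 1) / 2 * `|t *: V u|].
      by move=> /filter_ex.
    have : \forall t \near (0 : R)^'+,
      `|r (u + t *: V u) - r u - 'd r u (t *: V u)|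
         <= e / (`|V u| + 1) / 2 * `|t *: V u|.
      have ct : (fun t : R => t *: V u) @ (0 : R)^'+ --> (0 : 'rV[R]_m).
        rewrite -(scale0r (V u)); apply: cvg_at_right_filter.
        by apply: cvgZr_tmp; exact: cvg_id.
      exact: ct _ (diff_approx du e'0).
    move=> H; near=> t; split; last by near: t.
    - by near: t; exact: nbhs_right_gt.
    - rewrite -lerBrDl; near: t; apply: nbhs_right_le.
      by rewrite subr_gt0.
  (* The perturbation that places [u + t *: V u] in the cone at time [s + t]: a convex combination
     of [w] and [V u - v], both of norm at most [d]. *)
  pose w' := (s + t)^-1 *: (s *: w + t *: (V u - v)).
  have st0 : 0 < s + t by rewrite ltr_wpDl.
  have w'd : `|w'| <= d.
    rewrite normrZ gtr0_norm ?invr_gt0 // ler_pdivrMl //.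
    apply: (le_trans (ler_normD _ _));
      rewrite !normrZ ger0_norm // gtr0_norm //.
    by rewrite mulrDl; apply: lerD; apply: ler_wpM2l => //; exact: ltW.
  have cw' : cone (s + t) w' = u + t *: V u.
    by apply/rowP => i; rewrite /u /w' /cone -/v !mxE; field; rewrite gt_eqF.
  have := smin (s + t, w').
  rewrite inE /= in_itv /= tss w'd ltW // => /(_ (conj isT isT)).
  rewrite cw' -/u => le1.
  move: rt; rewrite linearZ /= dV scaler0 subr0 normrZ gtr0_norm // => rt.
  have := le_trans (ler_norm _) rt => {}rt.
  have : e / (`|V u| + 1) / 2 * (t * `|V u|) <= e * t / 2.
    have -> : e / (`|V u| + 1) / 2 * (t * `|V u|)
        = e * t / 2 * (`|V u| / (`|V u| + 1)).
      by field; rewrite gt_eqF.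
    apply: ler_piMr; first by rewrite divr_ge0 // mulr_ge0 // ltW.
    by rewrite ler_pdivrMr // mul1r lerDl.
  have : 0 < e * t by rewrite mulr_gt0.
  move: le1 rt; rewrite mulrDr; set X := r _; set Y := r _; lra.
(* The minimum of [r] on the slice at time [s0] is zero: were it positive, [small] with [e] half of
   it divided by [s0] would give a smaller value. *)
have [] := @compact_EVT_min _ R (fun w => r (cone s0 w))
  [set w : 'rV[R]_m | `|w| <= d].
- by exists 0; rewrite /= normr0 ltW.
- exact: compact_norm_le.
- apply: continuous_in_subspaceT => w; rewrite inE => /= wd.
  apply: (@continuous_comp _ _ _ (fun w => u0 + s0 *: (V u0 + w)) r).
    exact: cone_cont'.
  have [] // := nearD _ (coneD s0 w (ltW s00) (lexx _) wd) => dr _ _ _.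
  exact: differentiable_continuous.
move=> w; rewrite inE /= => wd wmin; exists w => //.
have [] // := nearD _ (coneD s0 w (ltW s00) (lexx _) wd) => _ _ _ rw.
apply/eqP; rewrite eq_le rw andbT leNgt; apply/negP => rw0.
have [|w2 w2d] := small (r (cone s0 w) / s0 / 2); first by rewrite !divr_gt0.
have := wmin w2; rewrite inE /= => /(_ w2d) /le_trans H /H.
rewrite mulrAC divfK ?gt_eqF // => {}H.
by move: rw0 H; set X := r _; lra.
Unshelve. all: by end_near. Qed.

(** By [viability], [r] and hence [h] vanish at points [u0 + s *: (V u0 + w)] with [w] as small as
    desired. A nonzero derivative of [h] along [V u0] would contradict the first-order expansion of
    [h] there. *)
Lemma diff_zero_set_viability (h : 'rV[R]_m -> R) :
  (\forall u \near u0, r u = 0 -> h u = 0) -> differentiable h u0 ->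
  h u0 = 0 -> 'd h u0 (V u0) = 0.
Proof.
move=> rh dh h0; apply: contrapT => /eqP hv.
have [C C0 hC] := linear_lipschitz (diff_continuous dh).
set c := `|'d h u0 (V u0)|.
have c0 : 0 < c by rewrite normr_gt0.
(* [C] is a Lipschitz constant of the differential: [d] makes its value at [w] at most [c / 4], and
   [e] makes the remainder divided by [s] at most [c / 4], so that [c <= c / 2]. *)
pose d := c / (4 * C).
have d0 : 0 < d by rewrite divr_gt0 // mulr_gt0.
have K0 : 0 < `|V u0| + d by rewrite ltr_wpDl.
pose e := c / (4 * (`|V u0| + d)).
have e0 : 0 < e by rewrite divr_gt0 // mulr_gt0.
have /nbhs_ballP[D /= D0 nearD] := diff_approx dh e0.
move: rh => /nbhs_ballP[D' /= D'0 nearD'].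
(* The right-hand neighbourhoods of [0] form a proper filter, so a contradiction for all small
   positive [s] is enough. *)
have := viability d0 => /filterS2-/(_
  (fun s => 0 < s /\ s * (`|V u0| + d) < Num.min D D')).
move=> /(_ (fun=> False)) H; apply: (@have_near _ _ (0 : R)^'+ False).
apply: H; last first.
  near=> s; split; first by near: s; exact: nbhs_right_gt.
  rewrite -ltr_pdivlMr //; near: s; apply: nbhs_right_lt.
  by rewrite divr_gt0 // lt_min D0.
move=> s [w wd rw] [s0]; rewrite lt_min => /andP[sD sD'].
set y := s *: (V u0 + w).
have yle : `|y| <= s * (`|V u0| + d).
  rewrite normrZ gtr0_norm //; apply: ler_wpM2l; first exact: ltW.
  by apply: (le_trans (ler_normD _ _)); exact: lerD.
have hy : h (u0 + y) = 0.
  apply: nearD' => //;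
    rewrite -ball_normE /ball_ /= opprD addrA subrr sub0r normrN.
  exact: le_lt_trans yle _.
have := nearD y;
  rewrite -ball_normE /ball_ /= sub0r normrN => /(_ (le_lt_trans yle sD)).
rewrite hy h0 subrr sub0r normrN /y linearZ /= normrZ gtr0_norm //.
move=> H1.
have : s * `|'d h u0 (V u0 + w)| <= e * (s * (`|V u0| + d)).
  by apply: (le_trans H1); apply: ler_wpM2l => //; exact: ltW.
have -> : e * (s * (`|V u0| + d)) = s * (c / 4).
  rewrite /e invfM; field; lra.
rewrite ler_pM2l // leNgt => /negP; apply.
have : c <= `|'d h u0 (V u0 + w)| + c / 4.
  rewrite /c -[in X in X <= _](addrK w (V u0)) linearB /=.
  apply: (le_trans (ler_normB _ _)); rewrite lerD2l.
  apply: (le_trans (hC _)).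
  have -> : `|'d h u0 (V u0)| / 4 = C * d.
    rewrite /d /c; field; lra.
  by apply: ler_wpM2l => //; exact: ltW.
lra.
Unshelve. all: by end_near. Qed.

End ZeroSetViability.

(** * Frames *)

(** Each basis vector other than the [j]-th is corrected along the [j]-th so as to become orthogonal
    to [w]. The resulting frame of the hyperplane varies continuously with [w] while [w 0 j] is
    nonzero. *)
Definition hyperplane_basis (R : fieldType) (m : nat) (j : 'I_m)
    (w : 'rV[R]_m) : 'M[R]_(m.-1, m) :=
  \matrix_(l, i) ((i == lift j l)%:R - w 0 (lift j l) / w 0 j * (i == j)%:R).

Lemma row_free_hyperplane_basis (R : fieldType) (m : nat) (j : 'I_m)
    (w : 'rV[R]_m) : row_free (hyperplane_basis j w).
Proof.
(* Deleting column [j] turns the matrix into the identity. *)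
apply/row_freeP; exists (\matrix_(i, l) (i == lift j l)%:R).
apply/matrixP => l l'; rewrite !mxE (bigD1 (lift j l')) //= big1 => [|i il'].
  rewrite !mxE eqxx mulr1 addr0 (inj_eq lift_inj) eq_sym.
  by rewrite [lift j l' == j]eq_sym (negPf (neq_lift _ _)) mulr0 subr0.
by rewrite !mxE (negPf il') mulr0.
Qed.

(** The rows are orthogonal to [w], and their rank [m.-1] is that of the kernel of [w^T]. *)
Lemma hyperplane_basisP (R : fieldType) (m : nat) (j : 'I_m) (w v : 'rV[R]_m) :
  w 0 j != 0 -> reflect (v *m w^T = 0) (v <= hyperplane_basis j w)%MS.
Proof.
move=> wj; have Cw : hyperplane_basis j w *m w^T = 0.
  apply/matrixP => l i; rewrite !mxE; rewrite {i}[i]ord1.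
  under eq_bigr do rewrite !mxE mulrBl -[X in _ - X]mulrA -[X in X - _]mul1r.
  have pick a k : \sum_i a * ((i == k)%:R * w 0 i) = a * w 0 k.
    rewrite (bigD1 k) //= big1 => [|i /negPf ->]; last by rewrite mul0r mulr0.
    by rewrite eqxx mul1r addr0.
  by rewrite sumrB !pick divfK // mul1r subrr.
have wn0 : w != 0 by apply: contraNneq wj => ->; rewrite mxE.
have CK : (hyperplane_basis j w == kermx w^T)%MS.
  rewrite -(mxrank_leqif_eq _) ?sub_kermx ?Cw // mxrank_ker mxrank_tr rank_rV
    wn0.
  by rewrite subn1 (eqP (row_free_hyperplane_basis j w)).
by rewrite (eqmxP CK); exact: sub_kermxP.
Qed.

Lemma hyperplane_frame (R : realType) (m : nat) (j : 'I_m) (w : 'rV[R]_m) :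
  w 0 j != 0 -> frame (hyperplane_basis j w) [set v | v *m w^T = 0].
Proof.
move=> wj; split; first exact: row_free_hyperplane_basis.
by apply/seteqP; split => v /= /(hyperplane_basisP _ wj).
Qed.

Lemma cvg_hyperplane_basis (R : realType) (T : Type) (F : set_system T)
    {FF : Filter F} (m : nat) (j : 'I_m) (w : T -> 'rV[R]_m) (w0 : 'rV[R]_m) :
  w0 0 j != 0 -> w @ F --> w0 ->
  (fun t => hyperplane_basis j (w t)) @ F --> hyperplane_basis j w0.
Proof.
move=> wj /(cvg_mx FF) cw; apply/(cvg_mx FF) => l i; rewrite mxE.
under eq_fun do rewrite mxE.
apply: cvgB; first exact: cvg_cst.
apply: cvgM; last exact: cvg_cst.
by apply: cvgM; [exact: cw|apply: cvgV => //; exact: cw].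
Qed.

Lemma frame_eq (R : realType) (m d : nat) (A B : 'M[R]_(d, m))
    (P Q : set 'rV[R]_m) :
  frame A P -> frame B Q -> P `<=` Q -> P = Q.
Proof.
move=> [fA ->] [fB ->] AB.
have sAB : (A <= B)%MS.
  by apply/row_subP => i; apply: AB; exact: row_sub.
have := mxrank_leqif_eq sAB; rewrite (eqP fA) (eqP fB) => -[_].
rewrite eqxx => /esym/eqmxP E.
by apply/seteqP; split => v /=; rewrite E.
Qed.

Lemma mulmx_trmx_eq0 (R : realType) (m : nat) (w : 'rV[R]_m) :
  w *m w^T = 0 -> w = 0.
Proof.
move=> /matrixP/(_ 0 0); rewrite !mxE => /eqP.
rewrite psumr_eq0 => [/allP H|i _]; last by rewrite mxE -expr2 sqr_ge0.
apply/rowP => i; rewrite mxE; apply/eqP.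
by have := H i (mem_index_enum i); rewrite mxE -expr2 sqrf_eq0.
Qed.

(** The row space of [P] has dimension [n] and the kernel of [A^T] at least [m - p]; as [p < n],
    they share a nonzero vector, normalised for later compactness arguments. *)
Lemma unit_orthogonal_vector (R : realType) (p n m : nat) (A : 'M[R]_(p, m))
    (P : 'M[R]_(n, m)) : (p < n)%N -> row_free P ->
  exists w : 'rV[R]_m, [/\ (w <= P)%MS, w *m A^T = 0 & `|w| = 1].
Proof.
move=> pn /eqP fP.
have : (P :&: kermx A^T)%MS != 0.
  rewrite -mxrank_eq0 -lt0n.
  have := mxrank_sum_cap P (kermx A^T); rewrite fP mxrank_ker mxrank_tr.
  have := rank_leq_col (P + kermx A^T)%MS.
  have := rank_leq_row A; have := rank_leq_col A; lia.
move=> /rowV0Pn[w]; rewrite sub_capmx => /andP[wP /sub_kermxP wA] w0.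
exists (`|w|^-1 *: w); split; first exact: scalemx_sub.
  by rewrite -scalemxAl wA scaler0.
by rewrite normrZ normfV normr_id mulVf // normr_eq0.
Qed.

(** Multiplying a vanishing combination by [w^T] kills the rows of [B] and leaves the coefficient of
    [w] times [w *m w^T], which is nonzero. *)
Lemma row_free_col_mx_orthogonal (R : realType) (n m : nat) (w : 'rV[R]_m)
    (B : 'M[R]_(n, m)) : row_free B -> w *m B^T = 0 -> w != 0 ->
  row_free (col_mx w B).
Proof.
move=> fB wB w0; rewrite -kermx_eq0; apply/rowV0P => v /sub_kermxP.
rewrite -[v]hsubmxK mul_row_col => H.
have Bw : B *m w^T = 0 by rewrite -[B]trmxK -trmx_mul wB trmx0.
have := congr1 (mulmx^~ w^T) H.
rewrite mulmxDl -!mulmxA Bw mulmx0 addr0 mul0mx.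
have ww : w *m w^T != 0 by apply: contraNneq w0 => /mulmx_trmx_eq0 ->.
rewrite [w *m w^T]mx11_scalar mul_mx_scalar => /eqP; rewrite scaler_eq0.
have -> : ((w *m w^T) 0 0 == 0) = false.
  apply/negbTE; apply: contra ww => /eqP E.
  by rewrite [w *m w^T]mx11_scalar E -scalemx1 scale0r.
move=> /= /eqP l0; move: H; rewrite l0 mul0mx add0r => rB.
by rewrite (row_free_inj fB (esym (etrans (mul0mx _ _) (esym rB)))) row_mx0.
Qed.

Lemma cvg_subsequence (phi : nat -> nat) : (forall i, (i <= phi i)%N) ->
  phi @ \oo --> \oo.
Proof.
move=> phiP; apply/cvgnyPge => N; exists N => // i /= Ni.
exact: leq_trans (phiP i).
Qed.

(** * Charts and tangent spaces *)

Section Charts.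
Context (R : realType) (m : nat) (M : topologicalType).
Implicit Types c d : chart R m M.

(** [chart_inv c] is arbitrary off the image of the chart, so its inverse property is carried along
    with the neighbourhood. *)
Lemma near_chart c (p : M) (O : set M) : chart_dom c p -> nbhs p O ->
  \forall u \near c p,
    [/\ O (chart_inv c u), chart_dom c (chart_inv c u) & c (chart_inv c u) = u].
Proof.
move=> cp Op.
have cod : (c @` chart_dom c) (c p) by exists p.
have near_cod : \forall u \near c p, (c @` chart_dom c) u.
  by apply: open_nbhs_nbhs; split => //; exact: chart_cod_open.
have near_O : \forall u \near c p, O (chart_inv c u).
  apply: (chart_inv_continuous cod); by rewrite chart_funK.
apply: filterS2 near_cod near_O => u [q cq <-]; rewrite chart_funK //.
Qed.

Lemma chart_image_nbhs c (p : M) (O : set M) : chart_dom c p -> nbhs p O ->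
  nbhs (c p) (c @` (O `&` chart_dom c)).
Proof.
move=> cp /(near_chart cp); apply: filterS => u [Ou cu cuE].
by exists (chart_inv c u).
Qed.

Lemma chart_dom_nbhs c (p : M) : chart_dom c p -> nbhs p (chart_dom c).
Proof. by move=> cp; apply: open_nbhs_nbhs; split => //;
  exact: chart_dom_open. Qed.

Lemma transition_nbhs c d (p : M) : chart_dom c p -> chart_dom d p ->
  nbhs (c p) (c @` (chart_dom c `&` chart_dom d)).
Proof.
move=> cp dp; rewrite setIC; apply: chart_image_nbhs => //.
exact: chart_dom_nbhs.
Qed.

Lemma transition_differentiable c d (p : M) : smooth_transition c d ->
  chart_dom c p -> chart_dom d p -> differentiable (d \o chart_inv c) (c p).
Proof.
move=> cd cp dp; apply: (smooth_on_differentiable cd).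
exact: nbhs_singleton (transition_nbhs cp dp).
Qed.

Lemma diff_change_chart (V : normedModType R) c d (h : M -> V) (p : M) :
  smooth_transition c d -> chart_dom c p -> chart_dom d p ->
  differentiable (h \o chart_inv d) (d p) ->
  differentiable (h \o chart_inv c) (c p) /\
  forall v, 'd (h \o chart_inv c) (c p) v
            = 'd (h \o chart_inv d) (d p) ('d (d \o chart_inv c) (c p) v).
Proof.
move=> cd cp dp dh.
have dcd := transition_differentiable cd cp dp.
have E : (d \o chart_inv c) (c p) = d p by rewrite /= chart_funK.
have dh' : differentiable (h \o chart_inv d) ((d \o chart_inv c) (c p)).
  by rewrite E.
have := diff_comp_near (h := h \o chart_inv c) dcd dh'.
rewrite E; apply.
have := near_chart cp (chart_dom_nbhs dp).
by apply: filterS => u [du _ _]; rewrite /= chart_funK.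
Qed.

(** Chain rule applied to [c] itself, whose expression in the chart [c] is the identity near
    [c p]. *)
Lemma transitionK c d (p : M) (v : 'rV[R]_m) :
  smooth_transition c d -> smooth_transition d c ->
  chart_dom c p -> chart_dom d p ->
  'd (c \o chart_inv d) (d p) ('d (d \o chart_inv c) (c p) v) = v.
Proof.
move=> cd dc cp dp; have dcd := transition_differentiable dc dp cp.
have [_ <-] := diff_change_chart cd cp dp dcd.
apply: diff_id_near.
by apply: filterS (near_chart cp filterT) => u [_ _ /= ->].
Qed.

End Charts.

Lemma diff_coord_eq0 (R : realType) (V : normedModType R) (p q : nat)
    (f : V -> 'M[R]_(p, q)) (x v : V) (i : 'I_p) (j : 'I_q) :
  differentiable f x -> (\forall y \near x, f y i j = 0) -> 'd f x v i j = 0.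
Proof.
move=> df f0; rewrite -deriveE // derive_mx; last exact: diff_derivable.
rewrite mxE (near_eq_derive (g := cst 0)) ?derive_cst //.
Qed.

(** * Smoothness along straight lines *)

Lemma Ck_ext (R : realType) (V W : normedModType R) (k : nat) (U : set V)
    (f g : V -> W) : open U -> {in U, f =1 g} -> Ck k U f -> Ck k U g.
Proof.
move=> oU; elim: k f g => [|k IH] f g fg /=.
  move=> cf x Ux; apply: near_eq_continuous (cf x Ux).
  have : nbhs x U by apply: open_nbhs_nbhs.
  by apply: filterS => y Uy; rewrite fg // inE.
move=> [df Cf]; split.
  move=> x Ux; have [] // := @near_eq_diff _ _ _ f g x (df x Ux).
  have : nbhs x U by apply: open_nbhs_nbhs.
  by apply: filterS => y Uy; rewrite fg // inE.
move=> v; apply: (IH (fun x => 'D_v f x)) => // x; rewrite inE => Ux.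
apply: near_eq_derive.
have : nbhs x U by apply: open_nbhs_nbhs.
by apply: filterS => y Uy; rewrite fg // inE.
Qed.

Lemma line_is_diff (R : realType) (V : normedModType R) (a w : V) (t : R) :
  is_diff t (fun t => a + t *: w) (fun t => t *: w).
Proof.
have := is_diffD (is_diff_cst a t) (is_diff_scalel t w).
by move=> [? E]; apply: DiffDef => //; rewrite E; apply/funext => s;
  rewrite !fctE add0r.
Qed.

(** The factor [s] lets the induction close: the derivative along [v] at [t] is [s * v] times the
    derivative of [f] along [w] at [a + t *: w]. *)
Lemma Ck_line (R : realType) (V W : normedModType R) (k : nat) (U : set V)
    (B : set R) (f : V -> W) (a w : V) (s : R) :
  open B -> (forall t, B t -> U (a + t *: w)) -> Ck k U f ->
  Ck k B (fun t => s *: f (a + t *: w)).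
Proof.
move=> oB BU; elim: k f s => [|k IH] f s /=.
  move=> cf t Bt; apply: (cvgZl_tmp (F := nbhs t)).
  apply: (@continuous_comp _ _ _ (fun t : R => a + t *: w) f);
    last exact: cf _ (BU _ Bt).
  by apply: differentiable_continuous; have [] := line_is_diff a w t.
move=> [df Cf].
have dc t : B t -> differentiable (f \o (fun t => a + t *: w)) t /\
    forall v, 'd (f \o (fun t => a + t *: w)) t v = 'd f (a + t *: w) (v *: w).
  move=> Bt; have [dl El] := line_is_diff a w t.
  have dft := df _ (BU _ Bt).
  split; first exact: differentiable_comp.
  by move=> v; rewrite diff_comp //= El.
split=> [t Bt|v].
  by apply: differentiableZ; case: (dc t Bt).
have := IH (fun x => 'D_w f x) (s * v) (Cf w).
apply: Ck_ext => //.
  move=> t; rewrite inE => Bt; have [dct Ect] := dc t Bt.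
  apply: esym; rewrite deriveE; last exact: differentiableZ.
  rewrite (diffZ (f := f \o (fun t => a + t *: w))) //=.
  rewrite Ect linearZ /= scalerA deriveE //; exact: df _ (BU _ Bt).
Qed.

Lemma smooth_on_line (R : realType) (V W : normedModType R) (U : set V)
    (B : set R) (f : V -> W) (a w : V) :
  open B -> (forall t, B t -> U (a + t *: w)) -> smooth_on U f ->
  smooth_on B (fun t => f (a + t *: w)).
Proof.
move=> oB BU sf k; have := @Ck_line R V W k U B f a w 1 oB BU (sf k).
by congr (Ck _ _ _); apply/funext => t; rewrite scale1r.
Qed.

(** [pid_mx n] serves as the standard frame of the model subspace of an adapted chart. *)
Lemma sub_pid_mxP (F : fieldType) (n m : nat) (w : 'rV[F]_m) : (n <= m)%N ->
  (w <= (pid_mx n : 'M[F]_(n, m)))%MS <->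
  forall j : 'I_m, (n <= j)%N -> w 0 j = 0.
Proof.
move=> nm; split=> [/submxP[D ->] j nj|w0].
  rewrite mxE big1 // => i _; rewrite mxE [_ == _ :> nat]ltn_eqF ?mulr0 //.
  exact: leq_trans (ltn_ord i) nj.
suff -> : w = (\row_(i < n) w 0 (widen_ord nm i)) *m pid_mx n by exact: submxMl.
apply/rowP => j; rewrite mxE; have [nj|jn] := leqP n j.
  rewrite w0 // big1 // => i _; rewrite !mxE [_ == _ :> nat]ltn_eqF ?mulr0 //.
  exact: leq_trans (ltn_ord i) nj.
rewrite (bigD1 (Ordinal jn)) //= big1 => [|i ij]; last first.
  by rewrite !mxE (_ : (i == j :> nat) = false) ?mulr0 //; apply/negbTE.
rewrite !mxE eqxx jn mulr1 addr0; congr (w _ _); exact: val_inj.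
Qed.

(** * Tangent spaces in an adapted chart *)

Section Tangent.
Context (R : realType) (m : nat) (M : manifold R m).

Section AdaptedChart.
Variables (n : nat) (X : set M) (x : M) (c : chart R m M).
Hypothesis smooth_c : smooth_chart c.
Hypothesis cx : chart_dom c x.
Hypothesis cX : forall p, chart_dom c p ->
  (X p <-> forall j : 'I_m, (n <= j)%N -> c p 0 j = 0).

Let cp := smooth_c x.

Lemma tangent_adapted_chart (v : tangent_vector x) : X x ->
  tangent X x v <-> forall j : 'I_m, (n <= j)%N ->
    'd (c \o chart_inv (chart_at x)) (chart_at x x) v 0 j = 0.
Proof.
have xx := chart_at_dom x; have [xc cx'] := cp.
have dxc := transition_differentiable xc xx cx.
move=> Xx; split=> [[g [e [e0 g0 gX sg vE]]] j nj|vj].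
  have B0 : nbhs (0 : R) (ball (0 : R) e) by exact: nbhsx_ballx.
  have dg : differentiable (chart_at x \o g) (0 : R).
    exact: smooth_on_differentiable sg (nbhs_singleton B0).
  have gx0 : (chart_at x \o g) 0 = chart_at x x by rewrite /= g0.
  have dxc' : differentiable (c \o chart_inv (chart_at x))
      ((chart_at x \o g) 0).
    by rewrite gx0.
  have nearE : {near (0 : R), ((c \o chart_inv (chart_at x)) \o (chart_at x \o
    g)) =1
      c \o g}.
    apply: filterS B0 => t Bt /=; rewrite chart_funK //; by have [] := gX t Bt.
  have [dcg Ecg] := diff_comp_near dg dxc' nearE.
  rewrite vE derive1E' // -gx0 -Ecg.
  apply: (diff_coord_eq0 _ dcg).
  have near_c : \forall t \near (0 : R),
      chart_dom c (chart_inv (chart_at x) ((chart_at x \o g) t)).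
    apply: (@near_fun _ _ _ _ (fun u => chart_dom c (chart_inv (chart_at x) u))
             (differentiable_continuous dg)).
    rewrite gx0.
    by apply: filterS (near_chart xx (chart_dom_nbhs cx)) => u [].
  apply: filterS2 near_c B0 => t /= ct Bt.
  have [Xt xt] := gX t Bt; rewrite chart_funK // in ct.
  exact: (cX ct).1 Xt _ nj.
pose w := 'd (c \o chart_inv (chart_at x)) (chart_at x x) v.
have near_w : \forall t \near (0 : R),
    (c @` (chart_dom c `&` chart_dom (chart_at x))) (c x + t *: w).
  have [dl _] := line_is_diff (c x) w (0 : R).
  apply: (@near_fun _ _ _ _ (c @` (chart_dom c `&` chart_dom (chart_at x)))
           (differentiable_continuous dl)).
  rewrite /= scale0r addr0.
  exact: transition_nbhs.
move: near_w => /nbhs_ballP[e /= e0 eB].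
exists (fun t => chart_inv c (c x + t *: w)), e; split => //.
- by rewrite scale0r addr0 chart_funK.
- move=> t Bt; have [p [pc px] pE] := eB t Bt.
  rewrite -pE chart_funK //; split => //; apply/(cX pc) => j nj.
  by rewrite pE !mxE vj // mulr0 addr0; exact: (cX cx).1 Xx _ nj.
- apply: (smooth_on_line (f := chart_at x \o chart_inv c)) cx' => //.
  exact: ball_open.
- have [dl El] := line_is_diff (c x) w (0 : R).
  have dcx := transition_differentiable cx' cx xx.
  have E0 : c x + 0 *: w = c x by rewrite scale0r addr0.
  have dcx' : differentiable (chart_at x \o chart_inv c) (c x + (0 : R) *: w).
    by rewrite E0.
  rewrite derive1E'; last exact: (differentiable_comp dl dcx').
  rewrite (diff_comp dl dcx') /= El scale1r E0.
  by rewrite /w transitionK.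
Qed.

(** The standard frame of the model subspace is carried back by the differential of the transition,
    whose matrix [A] has inverse [B]. *)
Lemma tangent_adapted_frame : (n <= m)%N -> X x ->
  frame (pid_mx n *m lin1_mx ('d (chart_at x \o chart_inv c) (c x))
         : 'M[R]_(n, m))
    (tangent X x).
Proof.
move=> nm Xx; have xx := chart_at_dom x; have [xc cx'] := cp.
pose A := lin1_mx ('d (chart_at x \o chart_inv c) (c x)).
pose B := lin1_mx ('d (c \o chart_inv (chart_at x)) (chart_at x x)).
have AB : A *m B = 1%:M.
  apply/row_matrixP => i; rewrite !rowE mulmxA !mul_rV_lin1 mulmx1.
  exact: transitionK.
have BA : B *m A = 1%:M by exact: mulmx1C.
split.
  rewrite /row_free mxrankMfree ?rank_pid_mx //.
  by apply/row_freeP; exists B; exact: AB.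
have vE (v : 'rV[R]_m) :
    v = 'd (c \o chart_inv (chart_at x)) (chart_at x x) v *m A.
  by rewrite -(mul_rV_lin1 ('d (c \o chart_inv (chart_at x)) (chart_at x x)))
     -mulmxA BA mulmx1.
apply/seteqP; split => v /=.
  move/tangent_adapted_chart => /(_ Xx)/(sub_pid_mxP _ nm) vj.
  by rewrite (vE v); apply: submxMr; exact: vj.
move=> vA; apply/tangent_adapted_chart => //; apply/(sub_pid_mxP _ nm).
have -> : 'd (c \o chart_inv (chart_at x)) (chart_at x x) v = v *m B.
  by rewrite mul_rV_lin1.
by rewrite -[pid_mx n]mulmx1 -AB mulmxA; apply: submxMr.
Qed.
End AdaptedChart.
End Tangent.

(** * The projection and the control function in a chart *)

Lemma diff_coord (R : realType) (V : normedModType R) (p q : nat)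
    (f : V -> 'M[R]_(p, q)) (x v : V) (i : 'I_p) (j : 'I_q) :
  differentiable f x ->
  differentiable (fun y => f y i j) x /\
  'd (fun y => f y i j) x v = 'd f x v i j.
Proof.
move=> df.
have dfij : differentiable (fun y => f y i j) x.
  by apply: (differentiable_comp (g := fun N : 'M[R]_(p, q) => N i j) df);
    exact: differentiable_coord.
split => //; rewrite -!deriveE // derive_mx ?mxE //; exact: diff_derivable.
Qed.

Lemma smooth_fun_at_nbhs (R : realType) (m : nat) (M : manifold R m)
    (V : normedModType R) (h : M -> V) (p : M) : smooth_fun_at h p ->
  exists U, nbhs (chart_at p p) U /\ smooth_on U (h \o chart_inv (chart_at p)).
Proof.
move=> [Q [oQ Qp Qdom sQ]]; exists (chart_at p @` Q); split => //.
have nQ : nbhs p Q by apply: open_nbhs_nbhs.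
have := chart_image_nbhs (chart_at_dom p) nQ.
by rewrite setIidl.
Qed.

Lemma smooth_fun_at_differentiable (R : realType) (m : nat) (M : manifold R m)
    (V : normedModType R) (h : M -> V) (p : M) : smooth_fun_at h p ->
  differentiable (h \o chart_inv (chart_at p)) (chart_at p p).
Proof.
by move=> /smooth_fun_at_nbhs[U [/nbhs_singleton Up sU]];
  exact: smooth_on_differentiable sU Up.
Qed.

(** [dmap] refers to the charts at [p] and [f p], which need not vary continuously with [p]; it is
    compared here with the differential in fixed charts. *)
Lemma dmap_chart (R : realType) (m n : nat) (M : manifold R m)
    (N : manifold R n) (f : M -> N) (y p : M) (z : N) :
  chart_dom (chart_at y) p ->
  (\forall u \near chart_at y p,
     chart_dom (chart_at z) (f (chart_inv (chart_at y) u))) ->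
  differentiable (chart_at z \o f \o chart_inv (chart_at y)) (chart_at y p) ->
  forall v : tangent_vector p,
  dmap f p v = 'd (chart_at (f p) \o chart_inv (chart_at z)) (chart_at z (f p))
    ('d (chart_at z \o f \o chart_inv (chart_at y)) (chart_at y p)
       (dfun (chart_at y) p v)).
Proof.
move=> yp fz dG v; have pp := chart_at_dom p; have ff := chart_at_dom (f p).
have fpz := nbhs_singleton fz; rewrite chart_funK // in fpz.
have dt := transition_differentiable (chart_at_smooth z (f p)) fpz ff.
have E : (chart_at z \o f \o chart_inv (chart_at y)) (chart_at y p) =
    chart_at z (f p).
  by rewrite /= chart_funK.
have dt' : differentiable (chart_at (f p) \o chart_inv (chart_at z))
    ((chart_at z \o f \o chart_inv (chart_at y)) (chart_at y p)).
  by rewrite E.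
have nearE : {near chart_at y p,
    (chart_at (f p) \o chart_inv (chart_at z)) \o
    (chart_at z \o f \o chart_inv (chart_at y))
    =1 (chart_at (f p) \o f) \o chart_inv (chart_at y)}.
  by apply: filterS fz => u fu /=; rewrite chart_funK.
have [dH EH] := diff_comp_near dG dt' nearE.
have [_ EC] := diff_change_chart (chart_at_smooth p y) pp yp dH.
by apply: etrans (EC v) _; apply: etrans (EH _) _; rewrite E.
Qed.

(** Local triviality provides a point of the fibre above [y]; [phi] sends the zero of that fibre to
    [y], and [pi] sends it back to the base point. *)
Lemma tubular_projection_id (R : realType) (m k : nat) (M : manifold R m)
    (Y T : set M) (pi : M -> M) (y : M) :
  tubular_neighbourhood k Y T pi -> Y y -> pi y = y.
Proof.
move=> [_ _ [E [D [phi [phi' [[_ D0] _ _ phi0 piphi]]]]]] Yy.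
have [U [theta [[_ Uy] _ _ + _]]] := vb_locally_trivial E Yy.
move=> /(_ y 0 Yy Uy)[e [[ey _] _]].
by rewrite -ey -(phi0 e) piphi // vb_proj_scale phi0.
Qed.

(** On [T] the map [pi] is [vb_proj] after [phi']. In charts [F] is thus [G2 \o G1] near the point,
    and its Jacobian is a product of continuous Jacobians. *)
Lemma tubular_projection_C1 (R : realType) (m k : nat) (M : manifold R m)
    (Y T : set M) (pi : M -> M) (y : M) :
  tubular_neighbourhood k Y T pi -> Y y ->
  let F := chart_at y \o pi \o chart_inv (chart_at y) in
  [/\ \forall u \near chart_at y y, differentiable F u,
      \forall u \near chart_at y y,
        chart_dom (chart_at y) (pi (chart_inv (chart_at y) u)) &
      {for chart_at y y, continuous (jacobian F)}].
Proof.
move=> tubT Yy F; have piy := tubular_projection_id tubT Yy.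
move: tubT => [oT YT [E [D [phi [phi' [_ [_ sphi'] [_ phiK] _ piphi]]]]]].
have pi_T x : T x -> pi x = vb_proj (phi' x).
  by move=> Tx; have [Dx {1}<-] := phiK x Tx; rewrite piphi.
set e := phi' y; have pe : vb_proj e = y by rewrite -pi_T //; exact: YT.
have yy := chart_at_dom y; have ee := chart_at_dom e.
have [near_e /smooth_fun_at_nbhs[U1 [U1y sU1]]] := sphi' y (YT _ Yy).
have [near_y /smooth_fun_at_nbhs[U2 [U2e sU2]]] := vb_proj_smooth e.
rewrite pe in near_y sU2; rewrite -/e in near_e sU1.
set G1 := _ \o _ in sU1; set G2 := _ \o _ in sU2.
have G1y : G1 (chart_at y y) = chart_at e e by rewrite /G1 /= chart_funK.
have dG1 := smooth_on_differentiable sU1 (nbhs_singleton U1y).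
have cG1 := differentiable_continuous dG1.
have near_U2 : \forall u \near chart_at y y, U2 (G1 u).
  by apply: (@near_fun _ _ _ _ U2 cG1); rewrite G1y.
have near_dom : \forall u \near chart_at y y,
    chart_dom (chart_at y) (vb_proj (chart_inv (chart_at e) (G1 u))).
  apply: (@near_fun _ _ _ _
    (fun w => chart_dom (chart_at y) (vb_proj (chart_inv (chart_at e) w))) cG1).
  rewrite G1y; by apply: filterS (near_chart ee near_y) => w [].
have near_T : \forall u \near chart_at y y,
    [/\ T (chart_inv (chart_at y) u) &
        chart_dom (chart_at e) (phi' (chart_inv (chart_at y) u))].
  have nT : nbhs y T by apply: open_nbhs_nbhs; split => //; exact: YT.
  apply: filterS2 (near_chart yy nT) (near_chart yy near_e)
    => u [Tu _ _] [eu _ _].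
  by split.
have FE : \forall u \near chart_at y y, (G2 \o G1) u = F u.
  apply: filterS near_T => u [Tu eu]; rewrite /F /G2 /G1 /=.
  by rewrite chart_funK // pi_T.
have near_F : \forall u \near chart_at y y, differentiable F u /\
    jacobian F u = jacobian G1 u *m jacobian G2 (G1 u).
  apply: filterS3 (near_join FE) U1y near_U2 => u FEu U1u U2u.
  have d1 := smooth_on_differentiable sU1 U1u.
  have d2 := smooth_on_differentiable sU2 U2u.
  have [dF EF] := diff_comp_near d1 d2 FEu; split => //.
  apply/row_matrixP => i; rewrite !rowE mulmxA !mul_rV_lin1; exact: EF.
split.
- by apply: filterS near_F => u [].
- apply: filterS2 near_T near_dom => u [Tu eu].
  by rewrite pi_T // /G1 /= chart_funK.
- apply: (near_eq_continuous (f := fun u => jacobian G1 u *m jacobian G2 (G1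
  u))).
    by apply: filterS near_F => u [_ ->].
  apply: (cvg_mulmx (F := nbhs (chart_at y y)));
    first exact: jacobian_continuous sU1 U1y.
  have cJ : {for G1 (chart_at y y), continuous (jacobian G2)}.
    rewrite G1y; exact: jacobian_continuous sU2 U2e.
  exact: continuous_comp cG1 cJ.
Qed.

(** * The metric and the gradient in a fixed chart *)

Section Gram.
Context (R : realType) (m : nat) (M : manifold R m) (g : riemannian_metric M).

Lemma gram_unit (p : M) : gram g p \in unitmx.
Proof.
rewrite -row_free_unit -kermx_eq0; apply/rowV0P => v /sub_kermxP vG.
apply: contrapT => /eqP v0; have := gram_posdef g p v0.
by rewrite /gram_inner vG mul0mx mxE ltxx.
Qed.

(** [grad] is a choice with default [0], so a representing vector must be exhibited: the row of
    partial derivatives times the inverse Gram matrix. *)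
Lemma gradP (rho : M -> R) (p : M) (v : tangent_vector p) :
  gram_inner (gram g p) (grad g rho p) v = dfun rho p v.
Proof.
rewrite /grad; case: xgetP => [w _ ->//|/(_
  ((\row_i dfun rho p (delta_mx 0 i)) *m invmx (gram g p)))].
case=> w; rewrite /gram_inner mulmxKV ?gram_unit //.
rewrite mxE [in RHS](row_sum_delta w) /dfun linear_sum /=;
  apply: eq_bigr => i _.
by rewrite !mxE linearZ /= mulrC.
Qed.

(** The usual coefficients of the metric in the chart at [y], whereas [gram g p] refers to the chart
    at [p]. *)
Definition chart_gram (y : M) (u : 'rV[R]_m) : 'M[R]_m :=
  \matrix_(i, j) gram_inner (gram g (chart_inv (chart_at y) u))
     (coord_vector y (delta_mx 0 i) (chart_inv (chart_at y) u))
     (coord_vector y (delta_mx 0 j) (chart_inv (chart_at y) u)).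

Lemma chart_gramE (y p : M) : chart_dom (chart_at y) p ->
  let P := lin1_mx ('d (chart_at p \o chart_inv (chart_at y)) (chart_at y p)) in
  chart_gram y (chart_at y p) = P *m gram g p *m P^T.
Proof.
move=> yp P; apply/matrixP => i j; rewrite mxE chart_funK // /coord_vector.
rewrite -!mul_rV_lin1 -/P /gram_inner trmx_mul trmx_delta !mulmxA -colE.
by rewrite -!mulmxA -rowE [LHS]mxE [LHS]mxE.
Qed.

Lemma chart_gram_inner (y p : M) (v w : 'rV[R]_m) : chart_dom (chart_at y) p ->
  gram_inner (gram g p) (coord_vector y v p) (coord_vector y w p) =
  gram_inner (chart_gram y (chart_at y p)) v w.
Proof.
move=> yp; rewrite chart_gramE // /gram_inner /coord_vector -!mul_rV_lin1.
by rewrite trmx_mul !mulmxA.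
Qed.

Lemma chart_gram_sym (y : M) (u : 'rV[R]_m) :
  (chart_gram y u)^T = chart_gram y u.
Proof.
have tr00 (N : 'M[R]_1) : N 0 0 = N^T 0 0 by rewrite mxE.
apply/matrixP => i j; rewrite mxE [LHS]mxE [RHS]mxE /gram_inner.
by rewrite tr00 !trmx_mul gram_sym trmxK mulmxA.
Qed.

(** The matrix is congruent to [gram g p] through an invertible change of coordinates. *)
Lemma chart_gram_unit (y p : M) : chart_dom (chart_at y) p ->
  chart_gram y (chart_at y p) \in unitmx.
Proof.
move=> yp; rewrite chart_gramE //; set P := lin1_mx _.
have : P *m lin1_mx ('d (chart_at y \o chart_inv (chart_at p)) (chart_at p p))
  = 1%:M.
  apply/row_matrixP => i; rewrite !rowE mulmxA !mul_rV_lin1 mulmx1.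
  by apply: transitionK => //; [exact: chart_at_smooth|exact: chart_at_smooth|
    exact: chart_at_dom].
move=> /mulmx1_unit[uP _].
by rewrite !unitmx_mul unitmx_tr uP gram_unit.
Qed.

Lemma chart_gram_continuous (y : M) :
  {for chart_at y y, continuous (chart_gram y)}.
Proof.
apply/(cvg_mx (nbhs_filter _)) => i j.
have := gram_smooth g (delta_mx 0 i) (delta_mx 0 j) (chart_at_dom y).
move=> /smooth_fun_at_differentiable/differentiable_continuous.
by apply: near_eq_continuous; near=> u; rewrite mxE.
Unshelve. all: by end_near. Qed.

End Gram.

(** * The tangent space of [Y] as the orthogonal of the kernel of the projection *)

Section Control.
Context (R : realType) (m k : nat) (M : manifold R m) (g : riemannian_metric M).
Variables (Y T : set M) (pi : M -> M) (rho : M -> R) (y : M).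
Hypothesis subY : submanifold k Y.
Hypothesis tubT : tubular_neighbourhood k Y T pi.
Hypothesis control : control_function g Y T pi rho.
Hypothesis Yy : Y y.

Let c := chart_at y.
Let r := rho \o chart_inv c.
Let F := c \o pi \o chart_inv c.

(** [w] is the gradient of [rho] written in the chart at [y]; it is killed by the Jacobian because
    the gradient lies in the kernel of the projection. *)
Lemma near_control : \forall u \near c y, differentiable r u /\
  exists2 w : 'rV[R]_m, w *m jacobian F u = 0 &
    forall v, 'd r u v = gram_inner (chart_gram g y u) w v.
Proof.
have [dF piF _] := tubular_projection_C1 tubT Yy.
have [oT YT _] := tubT; have [srho _ _ dpi] := control.
have nT : nbhs y T by apply: open_nbhs_nbhs; split => //; exact: YT.
apply: filterS3 (near_chart (chart_at_dom y) nT) dF (near_join piF) => u [].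
set p := chart_inv _ u => Tp yp pu dFu piu.
have pp := chart_at_dom p.
have drp := smooth_fun_at_differentiable (srho p Tp).
rewrite -pu in dFu piu *.
have [dr drE] := diff_change_chart (chart_at_smooth y p) yp pp drp.
split => //; exists (dfun c p (grad g rho p)).
  rewrite mul_rV_lin1; have := dmap_chart yp piu dFu (grad g rho p).
  rewrite dpi // => H0.
  have piyp := nbhs_singleton piu; rewrite chart_funK // in piyp.
  (* The transition to the chart at [pi p] has an invertible differential, so the vanishing of
     [dmap pi] gives that of ['d F]. *)
  have K := transitionK ('d F (c p) (dfun c p (grad g rho p)))
    (chart_at_smooth y (pi p)) (chart_at_smooth (pi p) y) piyp (chart_at_dom
      (pi p)).
  by apply: etrans (esym K) _; apply: etrans (congr1 _ (esym H0)) _;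
    exact: linear0.
move=> v; rewrite drE -/(dfun rho p _) -(gradP g) -chart_gram_inner //.
congr (gram_inner _ _ _); apply: esym; apply: transitionK => //;
  exact: chart_at_smooth.
Qed.

(** With Jacobian [J] and Gram matrix [G], the metric orthogonal of the kernel of [J] consists of
    the vectors [z J^T G^-1]. The adjugate replaces the inverse, which changes only a scalar
    factor. *)
Let V (z : 'rV[R]_m) u := z *m (jacobian F u)^T *m \adj (chart_gram g y u).

(** Pairing the gradient [w] with [V z u] cancels the Gram matrix against its adjugate, up to the
    determinant, and leaves [w *m jacobian F u], which is zero. *)
Lemma near_control_kernel (z : 'rV[R]_m) :
  \forall u \near c y, 'd r u (V z u) = 0.
Proof.
apply: filterS near_control => u [_ [w wF ->]].
rewrite /gram_inner /V !trmx_mul trmxK trmx_adj chart_gram_sym.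
rewrite -!mulmxA [chart_gram g y u *m _]mulmxA mul_mx_adj.
by rewrite mul_scalar_mx -scalemxAr mulmxA wF mul0mx scaler0 mxE.
Qed.

Lemma kernel_field_continuous (z : 'rV[R]_m) : {for c y, continuous (V z)}.
Proof.
have [_ _ cF] := tubular_projection_C1 tubT Yy.
apply: (cvg_mulmx (F := nbhs (c y))); last first.
  by apply: cvg_adjugate; exact: chart_gram_continuous.
apply: (cvg_mulmx (F := nbhs (c y))); first exact: cvg_cst.
by apply: (cvg_trmx (F := nbhs (c y))).
Qed.

(** In an adapted chart [d], each coordinate of index at least [k] vanishes on [Y], the zero set of
    [rho]; [diff_zero_set_viability] then kills its derivative along [V z]. *)
Lemma kernel_field_tangent (z : 'rV[R]_m) : tangent Y y (V z (c y)).
Proof.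
have [km /(_ y Yy)[d [sd dy dY]]] := subY.
have yy := chart_at_dom y.
have [oT YT _] := tubT; have [srho rho_ge0 rho0 _] := control.
have nT : nbhs y T by apply: open_nbhs_nbhs; split => //; exact: YT.
apply/(tangent_adapted_chart sd dy dY) => // j kj.
have dd := transition_differentiable (sd y).1 yy dy.
have [dh dhE] := @diff_coord _ _ _ _ _ _ (V z (c y)) 0 j dd.
have r_diff : \forall u \near c y, differentiable r u.
  by apply: filterS near_control => u [].
have r_ge0 : \forall u \near c y, 0 <= r u.
  by apply: filterS (near_chart yy nT) => u [Tu _ _]; exact: rho_ge0.
have r0 : r (c y) = 0.
  by rewrite /r /= chart_funK //; apply/rho0 => //; exact: YT.
have rd0 : \forall u \near c y, r u = 0 ->
    (d \o chart_inv (chart_at y)) u 0 j = 0.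
  apply: filterS2 (near_chart yy nT) (near_chart yy (chart_dom_nbhs dy))
    => u [Tu _ _] [du _ _].
  by move=> /(rho0 _ Tu) Yu; exact: (dY _ du).1 Yu _ kj.
have d0 : (d \o chart_inv (chart_at y)) (c y) 0 j = 0.
  by rewrite /= chart_funK //; exact: (dY _ dy).1 Yy _ kj.
have H := diff_zero_set_viability r_diff (@near_control_kernel z)
  (@kernel_field_continuous z) r_ge0 r0 rd0 dh d0.
exact: etrans (esym dhE) H.
Qed.

(** [pi] fixes the curves drawn on [Y]; differentiate this identity. *)
Lemma jacobian_projection_tangent (v : tangent_vector y) :
  tangent Y y v -> v *m jacobian F (c y) = v.
Proof.
move=> [h [e [e0 h0 hY sh ->]]]; have yy := chart_at_dom y.
have [dF _ _] := tubular_projection_C1 tubT Yy.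
have B0 : nbhs (0 : R) (ball (0 : R) e) by exact: nbhsx_ballx.
have dh : differentiable (chart_at y \o h) (0 : R).
  exact: smooth_on_differentiable sh (nbhs_singleton B0).
have hy0 : (chart_at y \o h) 0 = c y by rewrite /= h0.
have dF' : differentiable F ((chart_at y \o h) 0).
  by rewrite hy0; exact: nbhs_singleton dF.
have nearE : {near (0 : R), F \o (chart_at y \o h) =1 chart_at y \o h}.
  apply: filterS B0 => t Bt; have [Yt yt] := hY t Bt.
  by rewrite /F /= chart_funK // (tubular_projection_id tubT).
have [_ Fh] := diff_comp_near dh dF' nearE.
by rewrite derive1E' // mul_rV_lin1 -hy0 -Fh.
Qed.

(** The row space of [J^T *m \adj G] lies in the tangent space of [Y], which lies in the row space
    of [J]. The outer two have equal rank since [\adj G] is invertible, so every tangent [v] is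
    [V z (c y)] for some [z], and [V z] is the field sought. *)
Lemma tangent_kernel_field (v : tangent_vector y) : tangent Y y v ->
  exists W : 'rV[R]_m -> 'rV[R]_m, [/\ W (c y) = v, {for c y, continuous W} &
    \forall u \near c y, 'd r u (W u) = 0].
Proof.
have [km /(_ y Yy)[d [sd dy dY]]] := subY.
have := tangent_adapted_frame sd dy dY km Yy.
set B := _ *m _ => -[fB TB].
set J := jacobian F (c y); set G := chart_gram g y (c y).
have NB : (J^T *m \adj G <= B)%MS.
  apply/row_subP => i; have := kernel_field_tangent (delta_mx 0 i).
  by rewrite TB /= /V -mulmxA -rowE.
have BJ : (B <= J)%MS.
  apply/row_subP => i; have : tangent Y y (row i B).
    by rewrite TB /=; exact: row_sub.
  by move=> /jacobian_projection_tangent <-; exact: submxMl.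
have uG : \adj G \in unitmx.
  have := chart_gram_unit g (chart_at_dom y); rewrite -/c -/G => uG.
  have : ((\det G)^-1 *: G) *m \adj G = 1%:M.
    rewrite -scalemxAl mul_mx_adj -mul_scalar_mx -scalar_mxM mulVf //.
    by rewrite -unitfE -unitmxE.
  by move=> /mulmx1_unit[].
have BN : (B <= J^T *m \adj G)%MS.
  have := mxrank_leqif_eq NB => -[_ /esym].
  rewrite mxrankMfree ?row_free_unit // mxrank_tr.
  have -> : \rank J == \rank B.
    rewrite eqn_leq (mxrankS BJ) andbT.
    by have := mxrankS NB; rewrite mxrankMfree ?row_free_unit // mxrank_tr.
  by move=> /andP[].
rewrite TB /= => /submx_trans/(_ BN)/submxP[z ->].
exists (V z); split; first by rewrite /V mulmxA.
- exact: kernel_field_continuous.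
- exact: near_control_kernel.
Qed.

End Control.

(** * Limits of tangent spaces and kernels *)

Lemma cvg_near_unique (R : realType) (V : normedModType R) (T : Type)
    (F : set_system T) {FF : ProperFilter F} (f : T -> V) (a l : V) :
  (\forall t \near F, f t = a) -> f @ F --> l -> l = a.
Proof.
move=> fa fl; apply: (cvg_unique _ fl); first exact: norm_hausdorff.
exact: cvg_near_cst.
Qed.

(** * Passing from the chart at a point to a fixed chart *)

Section Push.
Context (R : realType) (m : nat) (M : manifold R m) (y x : M).
Hypothesis yx : chart_dom (chart_at y) x.

Lemma dfun_chartK (v : 'rV[R]_m) : dfun (chart_at y) x (coord_vector y v x) = v.
Proof.
by apply: transitionK => //; [exact: chart_at_smooth|exact: chart_at_smooth|
    exact: chart_at_dom].
Qed.

Lemma coord_vectorK (v : tangent_vector x) :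
  coord_vector y (dfun (chart_at y) x v) x = v.
Proof.
by apply: transitionK => //; [exact: chart_at_smooth|exact: chart_at_smooth|
    exact: chart_at_dom].
Qed.

Lemma frame_dfun_chart (d : nat) (A : 'M[R]_(d, m))
    (P : set (tangent_vector x)) :
  frame A P ->
  frame (A *m lin1_mx (dfun (chart_at y) x)) (dfun (chart_at y) x @` P).
Proof.
move=> [fA ->]; set L := lin1_mx _.
have LE (v : tangent_vector x) : v *m L = dfun (chart_at y) x v by exact:
  mul_rV_lin1.
pose K := lin1_mx ('d (chart_at x \o chart_inv (chart_at y)) (chart_at y x)).
have KE (v : 'rV[R]_m) : v *m K = coord_vector y v x by exact: mul_rV_lin1.
have LK : L *m K = 1%:M.
  by apply/row_matrixP => i; rewrite !rowE mulmxA LE KE mulmx1 coord_vectorK.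
have KL : K *m L = 1%:M by exact: mulmx1C.
split.
  by rewrite /row_free mxrankMfree //; apply/row_freeP; exists K; exact: LK.
apply/seteqP; split => [_ [v vA <-]|v vA] /=.
  by rewrite -LE; apply: submxMr.
exists (v *m K); last by rewrite -LE -mulmxA KL mulmx1.
by rewrite /= -[A]mulmx1 -LK mulmxA; apply: submxMr.
Qed.

Lemma dfun_chart_ker_d (rho : M -> R) : smooth_fun_at (rho : M -> R) x ->
  dfun (chart_at y) x @` ker_d rho x =
  [set v | 'd (rho \o chart_inv (chart_at y)) (chart_at y x) v = 0].
Proof.
move=> /smooth_fun_at_differentiable drx.
have [_ E] := diff_change_chart (chart_at_smooth y x) yx (chart_at_dom x) drx.
apply/seteqP; split => [_ [v v0 <-]|v v0] /=.
  apply: etrans (E _) _; rewrite -/(coord_vector y _ x) coord_vectorK;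
    exact: v0.
exists (coord_vector y v x); last exact: dfun_chartK.
exact: etrans (esym (E v)) v0.
Qed.

End Push.

Lemma cvg_near (T U : Type) (f : T -> U) (F : set_system T) (G : set_system U)
    (P : set U) :
  f @ F --> G -> (\forall y \near G, P y) -> \forall t \near F, P (f t).
Proof. by move=> fG /fG. Qed.

Lemma tangent_frame (R : realType) (m n : nat) (M : manifold R m) (X : set M)
    (x : M) :
  submanifold n X -> X x ->
  exists A : 'M[R]_(n, m), frame A (tangent X x).
Proof.
move=> [nm sX] Xx; have [c [sc cx cX]] := sX x Xx.
by eexists; exact: (tangent_adapted_frame sc cx cX nm Xx).
Qed.

(** [rho] is continuous and vanishes at [y], so [(m)] applies near [y]; it is invoked at the target
    [(0, 1)]. *)
Lemma condition_m_near (R : realType) (m k : nat) (M : manifold R m)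
    (X Y T : set M) (pi : M -> M) (rho : M -> R) (y : M) :
  submanifold k Y -> tubular_neighbourhood k Y T pi ->
  (forall x, T x -> smooth_fun_at (rho : M -> R) x) -> Y y -> rho y = 0 ->
  condition_m X Y T pi rho ->
  \forall x \near y, X x -> exists2 v, tangent X x v & dfun rho x v = 1.
Proof.
move=> subY tubT srho Yy rho0 [e e0 subm].
have yy := chart_at_dom y.
have piY x : T x -> Y (pi x).
  move: tubT => [_ _ [E [D [phi [phi' [_ _ [_ phiK] _ piphi]]]]]] Tx.
  have [Dx <-] := phiK x Tx; rewrite piphi //; exact: vb_proj_base.
have [oT YT _] := tubT; have nT : nbhs y T by apply: open_nbhs_nbhs;
  split => //; exact: YT.
have small_rho : \forall x \near y, rho x < e.
  have cr := differentiable_continuous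
    (smooth_fun_at_differentiable (srho y (YT _ Yy))).
  have cc := chart_fun_continuous yy.
  have crc : {for y, continuous ((rho \o chart_inv (chart_at y)) \o chart_at
    y)}.
    exact: continuous_comp cc cr.
  have crho : {for y, continuous rho}.
    apply: near_eq_continuous crc;
      apply: filterS (chart_dom_nbhs yy) => x yx /=.
    by rewrite chart_funK.
  by apply: (@near_fun _ _ _ _ (fun t => t < e) crho); rewrite rho0;
    exact: lt_nbhsl.
apply: filterS2 nT small_rho => x Tx rx Xx.
have [A [_ TA]] := tangent_frame subY (piY x Tx).
have T0 : tangent Y (pi x) 0 by rewrite TA /=; exact: sub0mx.
have [v Xv [_ rv]] := subm x Xx Tx rx 0 1 T0.
by exists v.
Qed.

(** * Convergent subsequences of kernels and tangent spaces *)

Section Limits.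
Context (R : realType) (m n : nat) (M : manifold R m).
Variables (X : set M) (rho : M -> R) (y : M) (x : nat -> M).
Variable tau : set (tangent_vector y).
Hypothesis subX : submanifold n.+1 X.
Hypothesis pre : pre_regular n.+1 X rho y x tau.
Hypothesis near_rho : \forall z \near y, [/\ smooth_fun_at (rho : M -> R) z &
  X z -> exists2 v, tangent X z v & dfun rho z v = 1].

Let c := chart_at y.
Let r := rho \o chart_inv c.

(** Each tangent space is spanned by the given frame of its intersection with the kernel and a unit
    vector orthogonal to that frame; each kernel is the orthogonal of a unit covector. Compactness
    yields limits of both. The last clause puts the value at [c y] of a continuous field killed by
    ['d r] into the limit of the kernels. *)
Lemma pre_regular_subsequence : exists (phi : nat -> nat) (o : 'rV[R]_m)
    (sigma : set (tangent_vector y)),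
  [/\ [/\ x \o phi @ \oo --> y, pre_regular n.+1 X rho y (x \o phi) tau &
          planes_cvg n.+1 (x \o phi) (fun i => tangent X (x (phi i))) y sigma],
      planes_cvg m.-1 (x \o phi) (fun i => ker_d rho (x (phi i))) y
        [set v | v *m o^T = 0],
      (tau `<=` [set v | v *m o^T = 0] /\ tau `<=` sigma),
      (exists B : 'M[R]_(n, m), frame B tau) &
      forall W : 'rV[R]_m -> 'rV[R]_m, {for c y, continuous W} ->
        (\forall u \near c y, 'd r u (W u) = 0) -> W (c y) *m o^T = 0].
Proof.
have [Xx xy [A [B [nearA fB AB]]]] := pre.
have yy := chart_at_dom y.
pose L i := lin1_mx (dfun c (x i)).
have frameX i := tangent_frame subX (Xx i).
have [P fP] := choice frameX.
have good : \forall i \near \oo, [/\ chart_dom c (x i),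
    frame (A i) (dfun c (x i) @` (ker_d rho (x i) `&` tangent X (x i))),
    smooth_fun_at (rho : M -> R) (x i) &
    exists2 v, tangent X (x i) v & dfun rho (x i) v = 1].
  apply: filterS2 nearA (cvg_near xy near_rho) => i [cx fA] [srho vx];
    split => //.
  exact: vx (Xx i).
(* The differential of [rho] as a row in the chart at [y]; normalising it to [o] below keeps the
   kernel and gives a bounded sequence. *)
pose om i := \row_j 'd r (c (x i)) (delta_mx 0 j).
have omE i (v : 'rV[R]_m) : v *m (om i)^T = ('d r (c (x i)) v)%:M.
  rewrite [LHS]mx11_scalar; congr (_%:M).
  rewrite mxE [in RHS](row_sum_delta v) linear_sum /=; apply: eq_bigr => j _.
  by rewrite !mxE linearZ.
pose o i := `|om i|^-1 *: om i.
(* [A i] has [n] rows and the tangent space dimension [n.+1], which leaves room for [w]. Outside the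
   chart domain [w] defaults to [0], so that the whole sequence is bounded. *)
have exw i : exists w : 'rV[R]_m, `|w| <= 1 /\
    (chart_dom c (x i) ->
     [/\ (w <= P i *m L i)%MS, w *m (A i)^T = 0 & `|w| = 1]).
  have [cx|ncx] := pselect (chart_dom c (x i)); last first.
    by exists 0; split; rewrite ?normr0.
  have [fPL _] := frame_dfun_chart cx (fP i).
  have [|w [wP wA w1]] := @unit_orthogonal_vector _ n _ _ (A i) _ _ fPL.
    exact: ltnSn.
  by exists w; rewrite w1; split.
have [w wP] := choice exw.
have o1 i : `|o i| <= 1.
  rewrite normrZ normfV normr_id; have [->|om0] := eqVneq (om i) 0.
    by rewrite normr0 mulr0.
  by rewrite mulVf // normr_eq0.
have [phi1 [w0 [phi1P w_cvg]]] := bounded_cvg_subsequence (fun i => (wP i).1).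
have [phi2 [q0 [phi2P o_cvg]]] := bounded_cvg_subsequence (fun i => o1 (phi1
  i)).
pose phi i := phi1 (phi2 i).
have phiP i : (i <= phi i)%N by exact: leq_trans (phi2P i) (phi1P _).
have phi_oo := cvg_subsequence phiP.
have goodphi := cvg_near phi_oo good.
have wphi : (w \o phi) @ \oo --> w0.
  exact: cvg_comp (cvg_subsequence phi2P) w_cvg.
have ophi : (o \o phi) @ \oo --> q0 by exact: o_cvg.
have Aphi : (A \o phi) @ \oo --> B by exact: cvg_comp phi_oo AB.
have xphi : (x \o phi) @ \oo --> y by exact: cvg_comp phi_oo xy.
have uphi : (c \o (x \o phi)) @ \oo --> c y.
  exact: cvg_comp xphi (chart_fun_continuous yy).
have om_neq0 i : chart_dom c (x i) -> smooth_fun_at (rho : M -> R) (x i) ->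
    (exists2 v, tangent X (x i) v & dfun rho (x i) v = 1) -> om i != 0.
  move=> cx srho [v _ v1]; apply: contra_eq_neq v1 => om0.
  have : dfun c (x i) v *m (om i)^T = 0 by rewrite om0 trmx0 mulmx0.
  rewrite omE => /matrixP/(_ 0 0); rewrite !mxE eqxx mulr1n => H.
  have : (dfun c (x i) @` ker_d rho (x i)) (dfun c (x i) v).
    by rewrite dfun_chart_ker_d.
  move=> [v' v'0 v'E].
  have vE : v = v' by rewrite -[v](coord_vectorK cx) -v'E coord_vectorK.
  by rewrite vE v'0 eq_sym oner_eq0.
have kerE i : chart_dom c (x i) -> smooth_fun_at (rho : M -> R) (x i) ->
    om i != 0 -> dfun c (x i) @` ker_d rho (x i) = [set v | v *m (o i)^T = 0].
  move=> cx srho om0; rewrite dfun_chart_ker_d //.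
  have n0 : `|om i|^-1 != 0 by rewrite invr_eq0 normr_eq0.
  apply/seteqP; split => v /=; rewrite /o linearZ /= -scalemxAr omE.
    by move=> ->; rewrite raddf0 scaler0.
  move=> /eqP; rewrite scaler_eq0 (negPf n0) /= => /eqP/matrixP/(_ 0 0).
  by rewrite !mxE eqxx mulr1n.
(* Norms pass to the limit, so neither [w0] nor [q0] degenerates to zero. *)
have w0n : `|w0| = 1.
  apply: (@cvg_near_unique _ _ _ \oo _
    (fun i => `|(w \o phi) i|)); last exact: cvg_norm.
  by apply: filterS goodphi => i [cx _ _ _]; have [] := (wP (phi i)).2 cx.
have o0n : `|q0| = 1.
  apply: (@cvg_near_unique _ _ _ \oo _
    (fun i => `|(o \o phi) i|)); last exact: cvg_norm.
  apply: filterS goodphi => i [cx _ srho vx] /=.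
  have om0 := om_neq0 _ cx srho vx.
  by rewrite normrZ normfV normr_id mulVf // normr_eq0.
have w0B : w0 *m B^T = 0.
  apply: (@cvg_near_unique _ _ _ \oo _
    (fun i => (w \o phi) i *m ((A \o phi) i)^T)).
    by apply: filterS goodphi => i [cx _ _ _]; have [] := (wP (phi i)).2 cx.
  exact: cvg_mulmx wphi (cvg_trmx Aphi).
have Bo0 : B *m q0^T = 0.
  apply: (@cvg_near_unique _ _ _ \oo _
    (fun i => (A \o phi) i *m ((o \o phi) i)^T)).
    apply: filterS goodphi => i [cx [_ fA] srho vx] /=.
    have om0 := om_neq0 _ cx srho vx.
    apply/row_matrixP => l; rewrite row_mul row0.
    have : (dfun c (x (phi i)) @` ker_d rho (x (phi i))) (row l (A (phi i))).
      have : [set v | (v <= A (phi i))%MS] (row l (A (phi i)))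
        by exact: row_sub.
      by rewrite -fA => -[v [kv _] <-]; exists v.
    by rewrite kerE.
  exact: cvg_mulmx Aphi (cvg_trmx ophi).
have w0_neq0 : w0 != 0 by rewrite -normr_eq0 w0n oner_eq0.
(* This index serves [hyperplane_basis] for [q0] and for all covectors close to it. *)
have [j o0j] : exists j, q0 0 j != 0.
  apply: contrapT => nj; have : q0 = 0.
    apply/rowP => j; rewrite [RHS]mxE; apply: contrapT => /eqP H.
    by apply: nj; exists j.
  by move=> o00; move: o0n; rewrite o00 normr0 => /esym/eqP; rewrite oner_eq0.
have [rfB tauE] := fB.
(* [w0] completes the frame [B] of [tau] to a frame of the limit of the tangent spaces. *)
pose sig : 'M[R]_(n.+1, m) := col_mx w0 B.
exists phi, q0, [set v | (v <= sig)%MS]; split.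
- split; first exact: xphi.
    split; [by move=> i; exact: Xx|exact: xphi|].
    exists (A \o phi), B; split; [|exact: fB|exact: Aphi].
    by apply: filterS goodphi => i [].
  exists (fun i => col_mx (w (phi i)) (A (phi i)) : 'M[R]_(n.+1, m)), sig;
    split.
  + apply: filterS goodphi => i [cx fA srho vx]; split => //.
    have fPL := frame_dfun_chart cx (fP (phi i)).
    have [wPL wA w1] := (wP (phi i)).2 cx.
    have rf : row_free (col_mx (w (phi i)) (A (phi i))).
      by apply: row_free_col_mx_orthogonal fA.1 wA _;
        rewrite -normr_eq0 w1 oner_eq0.
    (* These [n.+1] independent rows lie in the image of the tangent space, which has that
       dimension, so they span it. *)
    pose C : 'M[R]_(n.+1, m) := col_mx (w (phi i)) (A (phi i)).
    have fC : frame C [set v | (v <= C)%MS] by [].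
    suff <- : [set v | (v <= C)%MS] =
        dfun c (x (phi i)) @` tangent X (x (phi i)) by [].
    apply: (frame_eq fC fPL) => v; rewrite fPL.2 => /submx_trans; apply.
    (* [n.+1] and [1 + n] are convertible, but [col_mx_sub] needs the latter. *)
    suff : (col_mx (w (phi i)) (A (phi i)) <= P (phi i) *m L (phi i))%MS by [].
    rewrite col_mx_sub wPL /=; apply/row_subP => l.
    have : [set v | (v <= A (phi i))%MS] (row l (A (phi i))) by exact: row_sub.
    rewrite -fA.2 => -[z [_ Xz] <-].
    have : (dfun c (x (phi i)) @` tangent X (x (phi i)))
        (dfun c (x (phi i)) z) by exists z.
    by rewrite fPL.2.
  + split => //; exact: row_free_col_mx_orthogonal.
  + exact: cvg_col_mx wphi Aphi.
- exists (fun i => hyperplane_basis j (o (phi i))), (hyperplane_basis j q0);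
  split.
  + have oj : (fun i => o (phi i) 0 j) @ \oo --> q0 0 j.
      by move/(cvg_mx _) : ophi; apply.
    have near_oj : \forall i \near \oo, o (phi i) 0 j != 0.
      exact: cvgr_neq0 oj o0j.
    apply: filterS2 goodphi near_oj => i [cx _ srho vx] oij; split => //.
    rewrite kerE //; last exact: om_neq0.
    exact: hyperplane_frame.
  + exact: hyperplane_frame.
  + exact: cvg_hyperplane_basis.
- split => v; rewrite tauE /=; last first.
    move=> vB; apply: (submx_trans vB).
    suff : (B <= col_mx w0 B)%MS by [].
    by rewrite -addsmxE addsmxSr.
  by move=> /submxP[D ->]; rewrite -mulmxA Bo0 mulmx0.
- by exists B.
- move=> W cW W0.
  apply: (@cvg_near_unique _ _ _ \oo _
    (fun i => W (c (x (phi i))) *m ((o \o phi) i)^T)).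
    apply: filterS (cvg_near uphi W0) => i /= Wi.
    by rewrite /o linearZ /= -scalemxAr omE Wi raddf0 scaler0.
  exact: cvg_mulmx (cvg_comp _ _ uphi cW) (cvg_trmx ophi).
Qed.

End Limits.

Theorem lemma2p3 (R : realType) (m n k : nat) (M : manifold R m)
    (g : riemannian_metric M) (X Y T : set M) (pi : M -> M) (rho : M -> R)
    (y0 : M) :
  submanifold n X -> submanifold k Y -> Y `<=` closure X ->
  tubular_neighbourhood k Y T pi -> control_function g Y T pi rho ->
  Y y0 ->
  whitney_a n X Y y0 -> condition_m X Y T pi rho ->
  condition_cd n X rho y0 ->
  c_regular n X Y rho y0.
Proof.
move=> subX subY _ tubT control Yy wa cm cd x tau pre v Yv.
have [srho _ rho0 _] := control.
have [oT YT _] := tubT.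
have near_rho : \forall z \near y0, [/\ smooth_fun_at (rho : M -> R) z &
    X z -> exists2 v, tangent X z v & dfun rho z v = 1].
  have nT : nbhs y0 T by apply: open_nbhs_nbhs; split => //; exact: YT.
  have rho_y : rho y0 = 0 by apply/rho0 => //; exact: YT.
  apply: filterS2 nT (condition_m_near subY tubT srho Yy rho_y cm) => z Tz H.
  by split => //; exact: srho.
(* For [n = 0] the tangent spaces of [X] are zero, yet near [y0] they contain a vector on which the
   differential of [rho] is [1]. From here on [n.-1] is a true predecessor. *)
case: n => [|n] in subX wa cd pre *.
  have [Xx xy _] := pre.
  have [i [_ /(_ (Xx i))[v' ]]] := filter_ex (cvg_near xy near_rho).
  have [A [_ ->]] := tangent_frame subX (Xx i).
  move=> /submxP[D ->]; rewrite (flatmx0 A) mulmx0 /dfun linear0 => /esym/eqP.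
  by rewrite oner_eq0.
have [phi [q [sigma [[xphi prephi cvg_sigma] cvg_mu [tau_mu tau_sigma] [B fB]
  qW]]]]
  :=
  pre_regular_subsequence subX pre near_rho.
have [C fC] := cd _ _ _ _ prephi cvg_mu cvg_sigma.
have tauI : tau `<=` [set v | v *m q^T = 0] `&` sigma.
  by move=> z tz; split; [exact: tau_mu|exact: tau_sigma].
(* [(c_d)] gives the intersection the dimension of [tau], so the two coincide. Membership in [sigma]
   comes from Whitney [(a)], membership in the limit of the kernels from a continuous field through
   [v]. *)
rewrite (frame_eq fB fC tauI); split; last first.
  have [Xphi _ _] := prephi.
  exact: wa Xphi xphi cvg_sigma v Yv.
have [W [Wy cW W0]] := tangent_kernel_field subY tubT control Yy Yv.
by rewrite /= -Wy; exact: qW.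
Qed.
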